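(* There are ELA-fields satisfying the Schanuel nullstellensatz which are not strongly exponentially-algebraically closed.
   Context: An E-field is a field $F$ of characteristic zero with a homomorphism $\exp:(F,+)\to(F^\times,\cdot)$. An ELA-field is an E-field that is algebraically closed and in which every nonzero element is some $\exp(a)$. An E-ring is a commutative ring with a homomorphism $\exp$ from its additive group to its group of units. $F[X_1,\ldots,X_n]^E$ is the ring of exponential polynomials over $F$, i.e. the free E-ring extension of the E-field $F$ on generators $X_1,\ldots,X_n$ (iterated exponentials allowed). An ELA-field $F$ satisfies the Schanuel nullstellensatz if whenever $f\in F[X_1,\ldots,X_n]^E$ is an exponential polynomial over $F$ not equal to $\exp(g)$ for any exponential polynomial $g$, there are $a_1,\ldots,a_n\in F$ with $f(a_1,\ldots,a_n)=0$. Let $G=\mathbb{G}_{\mathrm a}\times\mathbb{G}_{\mathrm m}$, $F$ an ELA-field, $V\subseteq G^n$ an irreducible subvariety over $F$ with prime ideal $I(V)\subseteq F[\bar X,\bar Y,\bar Y^{-1}]$. $V$ is additively free if $I(V)$ contains no $\sum r_iX_i-c$ with $r_i\in\mathbb{Z}$ not all zero, $c\in F$; multiplicatively free if $I(V)$ contains no $\prod Y_i^{r_i}-d$ with $r_i\in\mathbb{Z}$ not all zero, $d\in F^\times$. Let $R=F[X_1,\ldots,X_n,(Y_{m,i})_{m\in\mathbb{Z}\setminus\{0\},1\le i\le n}]$, with coherence polynomials $Y_{mr,i}^r-Y_{m,i}$ ($m\ne0$, $r\ge1$) and $Y_{m,i}Y_{-m,i}-1$. For a prime ideal $I$ of $R$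 containing these, $I_1$ is the ideal of those $f\in F[\bar X,\bar Y,\bar Y^{-1}]$ lying in $I$ after substituting $Y_i=Y_{1,i}$, $Y_i^{-1}=Y_{-1,i}$. An additively free $V$ is Kummer-generic if there is only one additively free prime ideal $I$ of $R$ (containing no $\sum r_iX_i-c$ with $r_i\in\mathbb{Z}$ not all zero, $c\in F$) containing the coherence polynomials with $I_1=I(V)$. A matrix $M\in\mathrm{Mat}_{n\times n}(\mathbb{Z})$ acts on $G^n$ linearly on additive and multiplicatively on multiplicative coordinates, and $M\cdot V$ is the image of $V$. $V$ is perfectly rotund if it is irreducible, $\dim V=n$, $\dim M\cdot V\ge\mathrm{rk}\,M+1$ whenever $0<\mathrm{rk}\,M<n$, and $V$ is additively free, multiplicatively free and Kummer-generic. $F$ is strongly exponentially-algebraically closed if it is an ELA-field and for each $n$, every perfectly rotund $V\subseteq G^n(F)$ and every finitely generated subfield $A$ of $F$ over which $V$ is defined, there is $\bar b\in F^n$ with $(\bar b,\exp(\bar b))$ generic in $V$ over $A$. *)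

(* Defs.v *)
From HB Require Import structures.
From mathcomp Require Import all_boot all_algebra.
From mathcomp Require Import boolp classical_sets.
(* [monalg] (polynomials in an arbitrary set of variables) and [mpoly]
   (finitely many variables) both declare [{mpoly R[n]}]; only the notations
   of the latter are wanted. *)
From mathcomp Require Import -(notations) monalg.
From mathcomp Require Import mpoly.

Set Implicit Arguments.
Unset Strict Implicit.
Unset Printing Implicit Defensive.

Import GRing.Theory.
Local Open Scope classical_set_scope.
Local Open Scope ring_scope.
Local Open Scope quotient_scope.

(* A homomorphism from the additive group of R to its group of units: the
   values of e are units, since e x * e (- x) = e 0 = 1. *)
Definition exponential (R : comPzRingType) (e : R -> R) :=
  e 0 = 1 /\ {morph e : x y / x + y >-> x * y}.

Definition E_field (F : fieldType) (e : F -> F) :=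
  [pchar F] =i pred0 /\ exponential e.

Definition ELA_field (F : fieldType) (e : F -> F) :=
  [/\ E_field e, GRing.closed_field_axiom F &
      forall y : F, y != 0 -> exists x, e x = y].

(* The free E-ring extension F[X_1, ..., X_n]^E, built as the quotient of the
   E-ring terms with constants in F by the least congruence that makes it an
   E-ring in which F embeds by an E-ring homomorphism. Its universal property
   is [expoly_free] below. *)

Inductive eterm (F : Type) (n : nat) : Type :=
| EConst of F
| EVar of 'I_n
| EAdd of eterm F n & eterm F n
| EOpp of eterm F n
| EMul of eterm F n & eterm F n
| EExp of eterm F n.

Arguments EConst {F n}.
Arguments EVar {F n}.

HB.instance Definition _ (F : Type) n := gen_eqMixin (eterm F n).
HB.instance Definition _ (F : Type) n := gen_choiceMixin (eterm F n).

Section ETermCongruence.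
Variables (F : fieldType) (e : F -> F) (n : nat).
Implicit Types (a b : F) (s t u : eterm F n).

Inductive eterm_eq : eterm F n -> eterm F n -> Prop :=
| Erefl t : eterm_eq t t
| Esym s t : eterm_eq s t -> eterm_eq t s
| Etrans s t u : eterm_eq s t -> eterm_eq t u -> eterm_eq s u
| EAdd_cong s s' t t' :
    eterm_eq s s' -> eterm_eq t t' -> eterm_eq (EAdd s t) (EAdd s' t')
| EOpp_cong s s' : eterm_eq s s' -> eterm_eq (EOpp s) (EOpp s')
| EMul_cong s s' t t' :
    eterm_eq s s' -> eterm_eq t t' -> eterm_eq (EMul s t) (EMul s' t')
| EExp_cong s s' : eterm_eq s s' -> eterm_eq (EExp s) (EExp s')
| EAddA s t u : eterm_eq (EAdd s (EAdd t u)) (EAdd (EAdd s t) u)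
| EAddC s t : eterm_eq (EAdd s t) (EAdd t s)
| EAdd0 t : eterm_eq (EAdd (EConst 0) t) t
| EAddN t : eterm_eq (EAdd (EOpp t) t) (EConst 0)
| EMulA s t u : eterm_eq (EMul s (EMul t u)) (EMul (EMul s t) u)
| EMulC s t : eterm_eq (EMul s t) (EMul t s)
| EMul1 t : eterm_eq (EMul (EConst 1) t) t
| EMulDl s t u :
    eterm_eq (EMul (EAdd s t) u) (EAdd (EMul s u) (EMul t u))
| EExp0 : eterm_eq (EExp (EConst 0)) (EConst 1)
| EExpD s t : eterm_eq (EExp (EAdd s t)) (EMul (EExp s) (EExp t))
| EConstD a b : eterm_eq (EConst (a + b)) (EAdd (EConst a) (EConst b))
| EConstM a b : eterm_eq (EConst (a * b)) (EMul (EConst a) (EConst b))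
| EConstE a : eterm_eq (EConst (e a)) (EExp (EConst a)).

Definition eterm_eqb s t := `[< eterm_eq s t >].

Lemma eterm_eqb_equiv : equiv_class_of eterm_eqb.
Proof.
split=> [t|s t|t s u]; first by apply/asboolP; exact: Erefl.
  by apply/asboolP/asboolP; exact: Esym.
by move=> /asboolP st /asboolP tu; apply/asboolP; exact: Etrans st tu.
Qed.

Canonical eterm_equiv := EquivRelPack eterm_eqb_equiv.

Definition expoly : Type := {eq_quot eterm_eqb}.
HB.instance Definition _ := Choice.on expoly.
HB.instance Definition _ := EqQuotient.on expoly.

Lemma expoly_eqP s t : eterm_eq s t <-> \pi_expoly s = \pi_expoly t.
Proof.
by split=> [st|/eqquotP/asboolP//]; apply/eqquotP/asboolP.
Qed.

Lemma reprK_expoly t : eterm_eq (repr (\pi_expoly t)) t.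
Proof. by apply/expoly_eqP; rewrite reprK. Qed.

Definition expoly_add (f g : expoly) : expoly := \pi_expoly (EAdd (repr f) (repr g)).
Definition expoly_opp (f : expoly) : expoly := \pi_expoly (EOpp (repr f)).
Definition expoly_mul (f g : expoly) : expoly := \pi_expoly (EMul (repr f) (repr g)).
Definition expoly_exp (f : expoly) : expoly := \pi_expoly (EExp (repr f)).
Definition expoly_const (a : F) : expoly := \pi_expoly (EConst a).
Definition expoly_var (i : 'I_n) : expoly := \pi_expoly (EVar i).

Lemma pi_expoly_add s t :
  expoly_add (\pi s) (\pi t) = \pi_expoly (EAdd s t).
Proof. by apply/expoly_eqP; apply: EAdd_cong; exact: reprK_expoly. Qed.
Lemma pi_expoly_opp s : expoly_opp (\pi s) = \pi_expoly (EOpp s).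
Proof. by apply/expoly_eqP; apply: EOpp_cong; exact: reprK_expoly. Qed.
Lemma pi_expoly_mul s t :
  expoly_mul (\pi s) (\pi t) = \pi_expoly (EMul s t).
Proof. by apply/expoly_eqP; apply: EMul_cong; exact: reprK_expoly. Qed.
Lemma pi_expoly_exp s : expoly_exp (\pi s) = \pi_expoly (EExp s).
Proof. by apply/expoly_eqP; apply: EExp_cong; exact: reprK_expoly. Qed.

Definition pi_expolyE :=
  (pi_expoly_add, pi_expoly_opp, pi_expoly_mul, pi_expoly_exp).

Lemma expoly_addA : associative expoly_add.
Proof.
elim/quotW=> s; elim/quotW=> t; elim/quotW=> u.
by rewrite !pi_expolyE; apply/expoly_eqP; exact: EAddA.
Qed.
Lemma expoly_addC : commutative expoly_add.
Proof.
elim/quotW=> s; elim/quotW=> t.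
by rewrite !pi_expolyE; apply/expoly_eqP; exact: EAddC.
Qed.
Lemma expoly_add0 : left_id (expoly_const 0) expoly_add.
Proof.
by elim/quotW=> t; rewrite !pi_expolyE; apply/expoly_eqP; exact: EAdd0.
Qed.
Lemma expoly_addN : left_inverse (expoly_const 0) expoly_opp expoly_add.
Proof.
by elim/quotW=> t; rewrite !pi_expolyE; apply/expoly_eqP; exact: EAddN.
Qed.
Lemma expoly_mulA : associative expoly_mul.
Proof.
elim/quotW=> s; elim/quotW=> t; elim/quotW=> u.
by rewrite !pi_expolyE; apply/expoly_eqP; exact: EMulA.
Qed.
Lemma expoly_mulC : commutative expoly_mul.
Proof.
elim/quotW=> s; elim/quotW=> t.
by rewrite !pi_expolyE; apply/expoly_eqP; exact: EMulC.
Qed.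
Lemma expoly_mul1 : left_id (expoly_const 1) expoly_mul.
Proof.
by elim/quotW=> t; rewrite !pi_expolyE; apply/expoly_eqP; exact: EMul1.
Qed.
Lemma expoly_mulDl : left_distributive expoly_mul expoly_add.
Proof.
elim/quotW=> s; elim/quotW=> t; elim/quotW=> u.
by rewrite !pi_expolyE; apply/expoly_eqP; exact: EMulDl.
Qed.

HB.instance Definition _ := GRing.isZmodule.Build expoly
  expoly_addA expoly_addC expoly_add0 expoly_addN.
HB.instance Definition _ := GRing.Zmodule_isComPzRing.Build expoly
  expoly_mulA expoly_mulC expoly_mul1 expoly_mulDl.

Lemma expoly_exponential : exponential (expoly_exp : expoly -> expoly).
Proof.
split; first by rewrite pi_expolyE; apply/expoly_eqP; exact: EExp0.
elim/quotW=> s; elim/quotW=> t.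
rewrite -[_ + _]/(expoly_add _ _) -[_ * _]/(expoly_mul _ _) !pi_expolyE.
by apply/expoly_eqP; exact: EExpD.
Qed.

Lemma expoly_constD : {morph expoly_const : a b / a + b >-> a + b}.
Proof. by move=> a b; rewrite [RHS]pi_expolyE; apply/expoly_eqP/EConstD. Qed.

Lemma expoly_constM : {morph expoly_const : a b / a * b >-> a * b}.
Proof. by move=> a b; rewrite [RHS]pi_expolyE; apply/expoly_eqP/EConstM. Qed.

Lemma expoly_constE a : expoly_const (e a) = expoly_exp (expoly_const a).
Proof. by rewrite pi_expolyE; apply/expoly_eqP/EConstE. Qed.

End ETermCongruence.

Fixpoint eterm_eval (F : Type) n (R : comPzRingType) (e : R -> R)
    (phi : F -> R) (x : 'I_n -> R) (t : eterm F n) : R :=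
  match t with
  | EConst a => phi a
  | EVar i => x i
  | EAdd s u => eterm_eval e phi x s + eterm_eval e phi x u
  | EOpp s => - eterm_eval e phi x s
  | EMul s u => eterm_eval e phi x s * eterm_eval e phi x u
  | EExp s => e (eterm_eval e phi x s)
  end.

Lemma eterm_eval_eq (F : fieldType) (eF : F -> F) n (R : comPzRingType)
    (e : R -> R) (phi : {rmorphism F -> R}) (x : 'I_n -> R) :
  exponential e -> (forall a, phi (eF a) = e (phi a)) ->
  forall s t, eterm_eq eF s t ->
  eterm_eval e phi x s = eterm_eval e phi x t.
Proof.
move=> [e0 eD] phiE s t; elim=> //=.
- by move=> ? ? ? _ -> _ ->.
- by move=> ? ? ? ? _ -> _ ->.
- by move=> ? ? _ ->.
- by move=> ? ? ? ? _ -> _ ->.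
- by move=> ? ? _ ->.
- by move=> *; rewrite addrA.
- by move=> *; rewrite addrC.
- by move=> *; rewrite rmorph0 add0r.
- by move=> *; rewrite rmorph0 addNr.
- by move=> *; rewrite mulrA.
- by move=> *; rewrite mulrC.
- by move=> *; rewrite rmorph1 mul1r.
- by move=> *; rewrite mulrDl.
- by rewrite rmorph0 rmorph1.
- by move=> *; rewrite rmorphD.
- by move=> *; rewrite rmorphM.
Qed.

(* E-ring homomorphisms F[X_1, ..., X_n]^E -> R over phi. *)
Definition expoly_hom (F : fieldType) (eF : F -> F) n (R : comPzRingType)
    (e : R -> R) (phi : F -> R) (h : expoly eF n -> R) :=
  [/\ {morph h : f g / f + g >-> f + g}, {morph h : f g / f * g >-> f * g},
      forall f, h (expoly_exp f) = e (h f) &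
      forall a, h (expoly_const eF n a) = phi a].

Lemma expoly_free (F : fieldType) (eF : F -> F) n (R : comPzRingType)
    (e : R -> R) (phi : {rmorphism F -> R}) (x : 'I_n -> R) :
  exponential e -> (forall a, phi (eF a) = e (phi a)) ->
  exists! h : expoly eF n -> R,
    expoly_hom e phi h /\ forall i, h (expoly_var eF i) = x i.
Proof.
move=> expe phiE; pose h (f : expoly eF n) := eterm_eval e phi x (repr f).
have hpi t : h (\pi t) = eterm_eval e phi x t.
  by apply: (eterm_eval_eq x expe phiE); exact: reprK_expoly.
exists h; split.
  split=> [|i]; last by rewrite hpi.
  split=> [|||a]; last by rewrite hpi.
  - by elim/quotW=> s; elim/quotW=> t; rewrite [_ + _]pi_expolyE !hpi.
  - by elim/quotW=> s; elim/quotW=> t; rewrite [_ * _]pi_expolyE !hpi.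
  - by elim/quotW=> s; rewrite pi_expolyE !hpi.
move=> g [[gD gM gE gC] gX]; apply/funext; elim/quotW=> t; rewrite hpi.
have g0 : g 0 = 0 by rewrite (gC 0) rmorph0.
elim: t => [a|i|s IHs t IHt|s IHs|s IHs t IHt|s IHs] /=.
- by rewrite -gC.
- by rewrite -gX.
- by rewrite IHs IHt -gD [_ + _]pi_expolyE.
- rewrite IHs -pi_expoly_opp; apply/eqP; rewrite eq_sym -addr_eq0 -gD.
  by rewrite -[expoly_opp _]/(- (_ : expoly eF n)) addNr g0.
- by rewrite IHs IHt -gM [_ * _]pi_expolyE.
- by rewrite IHs -gE pi_expolyE.
Qed.

(* Evaluation at a point of F^n: for an E-field, this is the homomorphism of
   [expoly_free] over the identity of F (see [expoly_eval_hom]). *)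
Definition expoly_eval (F : fieldType) (e : F -> F) n (x : 'I_n -> F)
  (f : expoly e n) : F := eterm_eval e id x (repr f).

Lemma expoly_evalE (F : fieldType) (e : F -> F) n (x : 'I_n -> F) t :
  exponential e -> expoly_eval x (\pi_(expoly e n) t) = eterm_eval e id x t.
Proof.
by move=> expe; apply: (eterm_eval_eq (phi := idfun) x expe) => //;
   exact: reprK_expoly.
Qed.

Lemma expoly_eval_hom (F : fieldType) (e : F -> F) n (x : 'I_n -> F) :
  exponential e ->
  expoly_hom e id (@expoly_eval F e n x) /\
  forall i, expoly_eval x (expoly_var e i) = x i.
Proof.
move=> expe; split=> [|i]; last by rewrite expoly_evalE.
split=> [|||a]; last by rewrite expoly_evalE.
- by elim/quotW=> s; elim/quotW=> t; rewrite [_ + _]pi_expolyE !expoly_evalE.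
- by elim/quotW=> s; elim/quotW=> t; rewrite [_ * _]pi_expolyE !expoly_evalE.
- by elim/quotW=> s; rewrite pi_expolyE !expoly_evalE.
Qed.

Definition schanuel_nullstellensatz (F : fieldType) (e : F -> F) :=
  forall n (f : expoly e n), (forall g : expoly e n, f <> expoly_exp g) ->
  exists x : 'I_n -> F, expoly_eval x f = 0.

Section Varieties.
Variables (F : fieldType) (n : nat).

(* The points of G^n(F) are the (x, y) : Gspace whose y_i are all nonzero. *)
Definition Gspace : Type := ('cV[F]_n * 'cV[F]_n)%type.
Definition Gn : set Gspace := [set p : Gspace | forall i : 'I_n, p.2 i 0 != 0].

(* F[X, Y, Y^-1] is presented as the polynomial ring in the 3n variables
   X_i, Y_i, Y_i^-1, modulo Y_i * Y_i^-1 = 1. Its ideals are thus represented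
   by their preimages in [laurent]; the ideals used below (vanishing ideals
   of subsets of Gn, and [level1] of an ideal containing the coherence
   polynomials) do contain the Y_i * Y_i^-1 - 1. *)
Definition laurent : Type := {mpoly F[n + n + n]}.
Definition LX (i : 'I_n) : {mpoly F[n + n + n]} := 'X_(lshift n (lshift n i)).
Definition LY (i : 'I_n) : {mpoly F[n + n + n]} := 'X_(lshift n (rshift n i)).
Definition LYinv (i : 'I_n) : {mpoly F[n + n + n]} := 'X_(rshift (n + n) i).

Definition leval (f : laurent) (p : Gspace) : F :=
  f.@[fun k => col_mx (col_mx p.1 p.2) (map_mx GRing.inv p.2) k 0].

Lemma leval_LX i p : leval (LX i) p = p.1 i 0.
Proof. by rewrite /leval mevalXU !col_mxEu. Qed.
Lemma leval_LY i p : leval (LY i) p = p.2 i 0.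
Proof. by rewrite /leval mevalXU col_mxEu col_mxEd. Qed.
Lemma leval_LYinv i p : leval (LYinv i) p = (p.2 i 0)^-1.
Proof. by rewrite /leval mevalXU col_mxEd mxE. Qed.

Definition zero_locus (P : set laurent) : set Gspace :=
  [set p : Gspace | Gn p /\ forall f, P f -> leval f p = 0].

Definition vanishing_ideal (S : set Gspace) : set laurent :=
  [set f | forall p, S p -> leval f p = 0].

Definition subvariety (V : set Gspace) := exists P, V = zero_locus P.

(* As F has characteristic zero, this is the same as I(V) being generated by
   polynomials over A. *)
Definition defined_over (A : set F) (V : set Gspace) :=
  exists2 P, (forall f, P f -> f \is a mpolyOver _ (mem A)) & V = zero_locus P.

Definition irreducible_subvariety (V : set Gspace) :=
  [/\ subvariety V, V !=set0 &
      forall W1 W2, subvariety W1 -> subvariety W2 ->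
        V `<=` W1 `|` W2 -> V `<=` W1 \/ V `<=` W2].

(* Dimension as transcendence degree: [dim_ge S d] when some d regular
   functions are algebraically independent over F as functions on S. As a
   regular function vanishes on S iff it does on the Zariski closure of S,
   this is the dimension of that closure. *)
Definition alg_independent_on (S : set Gspace) d (g : 'I_d -> laurent) :=
  forall q : {mpoly F[d]}, (forall p, S p -> q.@[fun k => leval (g k) p] = 0) ->
    q = 0.

Definition dim_ge (S : set Gspace) d :=
  exists g : 'I_d -> laurent, alg_independent_on S g.

Definition dim_eq (S : set Gspace) d := dim_ge S d /\ ~ dim_ge S d.+1.

Definition additively_free (V : set Gspace) :=
  forall (r : 'rV[int]_n) (c : F), r != 0 ->
    ~ vanishing_ideal V (\sum_i LX i *~ r 0 i - c%:MP).

Definition LYpow (i : 'I_n) (m : int) : {mpoly F[n + n + n]} :=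
  match m with Posz k => LY i ^+ k | Negz k => LYinv i ^+ k.+1 end.

Definition multiplicatively_free (V : set Gspace) :=
  forall (r : 'rV[int]_n) (d : F), r != 0 -> d != 0 ->
    ~ vanishing_ideal V (\prod_i LYpow i (r 0 i) - d%:MP).

Definition nzint := {m : int | m != 0}.
Definition nzint1 : nzint := exist _ 1 isT.
Definition nzintN1 : nzint := exist _ (-1) isT.

(* The ring F[X_i, Y_(m,i)], over the variables X_i (left) and Y_(m,i) (right). *)
Definition Rvar : Type := ('I_n + nzint * 'I_n)%type.
HB.instance Definition _ := Choice.on Rvar.
Definition kummer_ring : Type := malg (cmonom Rvar) F.
HB.instance Definition _ := GRing.ComNzRing.on kummer_ring.

Definition RC : F -> kummer_ring := @mkmalgU (cmonom Rvar) F mone.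
HB.instance Definition _ := GRing.RMorphism.copy RC RC.
Definition RX (i : 'I_n) : kummer_ring := mkmalgU (ucm (inl i : Rvar)) 1.
Definition RY (m : nzint) (i : 'I_n) : kummer_ring := mkmalgU (ucm (inr (m, i) : Rvar)) 1.

Definition coherence_root : set kummer_ring :=
  [set f | exists (m m' : nzint) (r : nat) (i : 'I_n),
     [/\ (0 < r)%N, val m' = val m * r%:Z & f = RY m' i ^+ r - RY m i]].

Definition coherence_inv : set kummer_ring :=
  [set f | exists (m m' : nzint) (i : 'I_n),
     val m' = - val m /\ f = RY m i * RY m' i - 1].

(* The substitution Y_i := Y_(1,i), Y_i^-1 := Y_(-1,i). *)
Definition Rsubst : laurent -> kummer_ring :=
  mmap RC (fun k =>
    match split k with
    | inl k' => match split k' with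
                | inl i => RX i
                | inr i => RY nzint1 i
                end
    | inr i => RY nzintN1 i
    end).

(* The ideal I_1. *)
Definition level1 (I : set kummer_ring) : set laurent := [set f | I (Rsubst f)].

(* [idealr_closed] includes properness. *)
Definition prime_ideal (I : set kummer_ring) :=
  idealr_closed (mem I) /\ prime_idealr_closed (mem I).

Definition additively_free_ideal (I : set kummer_ring) :=
  forall (r : 'rV[int]_n) (c : F), r != 0 ->
    ~ I (\sum_i RX i *~ r 0 i - RC c).

Definition Kummer_generic (V : set Gspace) :=
  additively_free V /\
  exists! I : set kummer_ring,
    [/\ prime_ideal I, additively_free_ideal I, coherence_root `<=` I,
        coherence_inv `<=` I & level1 I = vanishing_ideal V].

Definition mx_act (M : 'M[int]_n) (p : Gspace) : Gspace :=
  (map_mx intr M *m p.1, \col_i \prod_j p.2 j 0 ^ M i j).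

Definition mx_rank (M : 'M[int]_n) : nat := \rank (map_mx intr M : 'M[rat]_n).

Definition perfectly_rotund (V : set Gspace) :=
  [/\ irreducible_subvariety V,
      dim_eq V n,
      forall M : 'M[int]_n, (0 < mx_rank M < n)%N ->
        dim_ge (mx_act M @` V) (mx_rank M).+1 &
      [/\ additively_free V, multiplicatively_free V & Kummer_generic V]].

(* b is generic in V over A: it lies in no smaller A-closed set. *)
Definition generic_in (V : set Gspace) (A : set F) (b : Gspace) :=
  V b /\ forall W, defined_over A W -> W b -> V `<=` W.

End Varieties.

Definition fin_gen_subfield (F : fieldType) (A : set F) :=
  exists s : seq F,
    A = smallest [set B : set F | divring_closed (mem B)] [set` s].

Definition strongly_exp_alg_closed (F : fieldType) (e : F -> F) :=
  ELA_field e /\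
  forall n (V : set (Gspace F n)) (A : set F),
    perfectly_rotund V -> fin_gen_subfield A -> defined_over A V ->
    exists b : 'cV[F]_n, generic_in V A (b, map_mx e b).

(* Main.v *)
Require Import Defs.
From HB Require Import structures.
From mathcomp Require Import finmap.
From mathcomp Require Import all_boot all_order all_algebra all_field.
From mathcomp Require Import boolp classical_sets.
From mathcomp Require Import ring zify.
From mathcomp Require Import -(notations) monalg.
From mathcomp Require Import mpoly.

(* The field is Qbar = algC. Strong exponential-algebraic closedness fails there
   for every exponential: the curve Y = X in G is perfectly rotund and defined
   over Q, but it has no point over Qbar that is generic over Q.

   It remains to find a surjective exponential on Qbar satisfying the Schanuel
   nullstellensatz. It is the limit of a sequence of exponentials, each keeping
   the values of the previous one on a finite set and meeting one of countably
   many requirements. The main requirement concerns an exponential polynomial f.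
   Up to the congruence defining expoly, f is a Laurent polynomial in
   X_1, ..., X_n, exp(g_1), ..., exp(g_k) (with rational exponents on the
   exp(g_j)), where g_j only involves X_1, ..., X_n, exp(g_1), ..., exp(g_(j-1))
   and g_1, ..., g_k are linearly independent over Q modulo constants. If f
   depends on the last variable other than through a monomial, give the other
   variables values of very large degree over the number field generated so
   far; the g_j then take values that are linearly independent over Q modulo
   that number field, so that the values of exp at them can be prescribed, and
   f becomes a polynomial in one variable over Qbar with a nonzero root.
   Otherwise f = exp(q g_k) f' with f' shorter, and one goes on with f'; if this
   ends with a constant, f is an exponential. *)

Set Implicit Arguments.
Unset Strict Implicit.
Unset Printing Implicit Defensive.

Import Order.TTheory GRing.Theory Num.Theory.
Local Open Scope classical_set_scope.
Local Open Scope ring_scope.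

(** * Extending exponentials from Q-subspaces *)

Section ExtendingExponentials.
Variable F : numClosedFieldType.
Implicit Types (x y z : F) (M : set F).

Lemma exponential_neq0 (e : F -> F) x : exponential e -> e x != 0.
Proof.
move=> [e0 eD]; apply/eqP => ex0.
have /eqP[] := oner_neq0 F.
by rewrite -[LHS]e0 -[in LHS](subrr x) eD ex0 mul0r.
Qed.

Fixpoint root_tower z k : F :=
  if k is i.+1 then i.+1.-root (root_tower z i) else z.

Lemma root_tower_neq0 z k : z != 0 -> root_tower z k != 0.
Proof. by move=> z0; elim: k => //= k IH; rewrite rootC_eq0. Qed.

(** The candidate value at a rational [q] does not depend on which factorial serves as its
    denominator, because the [k.+1]-th power of entry [k.+1] of the tower is entry [k]. *)
Lemma root_towerX z k l (a b : int) (q : rat) : (k <= l)%N ->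
    q * k`!%:R = a%:~R -> q * l`!%:R = b%:~R ->
  root_tower z k ^ a = root_tower z l ^ b.
Proof.
move=> /subnKC <-; move: {l}(l - k)%N => d; elim: d k a => [|d IH] k a qa.
  by rewrite addn0 qa => /intr_inj->.
rewrite addnS -addSn => qb; have <- := IH k.+1 (k.+1%:Z * a) _ qb.
  by rewrite /= -exprz_exp -exprnP rootCK.
by rewrite factS natrM mulrCA qa intrM -pmulrn.
Qed.

Lemma mulq_denq (q : rat) : q * `|denq q|%N%:R = (numq q)%:~R.
Proof.
rewrite -[X in X * _]divq_num_den natr_absz gtr0_norm ?denq_gt0 //.
by rewrite divfK ?intr_eq0 ?denq_neq0.
Qed.

Lemma denq_fact (q : rat) : exists k, exists a : int, q * k`!%:R = a%:~R.
Proof.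
exists `|denq q|%N, (numq q * (`|denq q|.-1)`!%:Z).
rewrite -[in LHS](prednK (n := `|denq q|)) ?absz_gt0 ?denq_neq0 // factS.
by rewrite prednK ?absz_gt0 ?denq_neq0 // natrM mulrA intrM -pmulrn mulq_denq.
Qed.

Lemma denq_fact_le (q : rat) k l (a : int) : (k <= l)%N ->
  q * k`!%:R = a%:~R -> exists b : int, q * l`!%:R = b%:~R.
Proof.
move=> /subnKC <-; elim: (l - k)%N => [|d IH] qa; first by exists a; rewrite addn0.
have [b qb] := IH qa; exists ((k + d).+1%:Z * b).
by rewrite addnS factS natrM mulrCA qb intrM -pmulrn.
Qed.

(* [root_tower z k] is a [k!]-th root of [z], so it serves as the value at
   [1 / k!] of a homomorphism mapping [1] to [z]. *)
Lemma rat_hom z : z != 0 ->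
  exists t : rat -> F, t 1 = z /\ {morph t : p q / p + q >-> p * q}.
Proof.
move=> z0; have /choice [t tE] : forall q : rat, exists w, forall k (a : int),
    q * k`!%:R = a%:~R -> w = root_tower z k ^ a.
  move=> q; have [k [a qa]] := denq_fact q; exists (root_tower z k ^ a) => l b qb.
  case/orP: (leq_total k l) => kl; first exact: root_towerX qb.
  by apply: esym; exact: root_towerX qa.
exists t; split; first by rewrite (tE _ 0%N 1) // fact0 mulr1.
move=> p q; have [k [a pa]] := denq_fact p; have [l [b qb]] := denq_fact q.
have [a' pa'] := denq_fact_le (leq_addr l k) pa.
have [b' qb'] := denq_fact_le (leq_addl k l) qb.
rewrite (tE _ _ _ pa') (tE _ _ _ qb') (tE _ (k + l)%N (a' + b')).
  by rewrite exprzDr // unitfE root_tower_neq0.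
by rewrite mulrDl pa' qb' intrD.
Qed.

Definition qsubspace M :=
  [/\ M 0, forall x y, M x -> M y -> M (x + y) &
      forall (q : rat) x, M x -> M (ratr q * x)].

Lemma qsubspaceB M x y : qsubspace M -> M x -> M y -> M (x - y).
Proof.
move=> [_ MD MZ] Mx My; apply: MD => //.
by rewrite -mulN1r -(rmorphN1 (@ratr F)); apply: MZ.
Qed.

(** By Zorn, take a subspace maximal among those avoiding [y]. Adding any further [x] captures [y],
    and this relation solved for [x] puts [x] in [M] + Q [y]. *)
Lemma maximal_qsubspace M0 y : qsubspace M0 -> ~ M0 y ->
  exists M, [/\ qsubspace M, M0 `<=` M, ~ M y &
                forall x, exists q : rat, M (x - ratr q * y)].
Proof.
move=> sM0 M0y.
(* The property bears on the union with [M0] so that it also holds of the union of the empty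
   chain. *)
pose P M := qsubspace (M `|` M0) /\ ~ (M `|` M0) y.
have [C CP Ctot|M [[sM My] Mmax]] := @Zorn_bigcup F P.
  split; last by case=> // -[M CM My]; case: (CP _ CM) => _; apply; left.
  case: (sM0) => M00 M0D M0Z; split; first by right.
  - move=> u v; case=> [[Mu CMu Muu]|M0u]; case=> [[Mv CMv Mvv]|M0v].
    + have [M [CM Mu' Mv']] : exists M, [/\ C M, M u & M v].
        by case: (Ctot _ _ CMu CMv) => sub; [exists Mv|exists Mu]; split=> //; exact: sub.
      have [[_ /(_ u v) D _] _] := CP _ CM.
      by case: (D (or_introl Mu') (or_introl Mv')) => ?; [left; exists M|right].
    + have [[_ /(_ u v) D _] _] := CP _ CMu.
      by case: (D (or_introl Muu) (or_intror M0v)) => ?; [left; exists Mu|right].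
    + have [[_ /(_ u v) D _] _] := CP _ CMv.
      by case: (D (or_intror M0u) (or_introl Mvv)) => ?; [left; exists Mv|right].
    + by right; exact: M0D.
  - move=> q u [[Mu CMu Muu]|M0u]; last by right; exact: M0Z.
    have [[_ _ /(_ q u) Z] _] := CP _ CMu.
    by case: (Z (or_introl Muu)) => ?; [left; exists Mu|right].
exists (M `|` M0); split=> // x.
have [M1 MD MZ] := sM.
have [Mx|Mx] := pselect ((M `|` M0) x); first by exists 0; rewrite rmorph0 mul0r subr0.
(* [B] is the subspace generated by [x] and the maximal one. *)
pose B := [set v | exists q : rat, (M `|` M0) (v - ratr q * x)].
have BE : B `|` M0 = B.
  rewrite predeqE => v; split=> [[//|M0v]|]; last by left.
  by exists 0; rewrite rmorph0 mul0r subr0; right.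
have sB : qsubspace B.
  split; first by exists 0; rewrite rmorph0 mul0r subr0.
    move=> u v [q Mu] [r Mv]; exists (q + r).
    by have := MD _ _ Mu Mv; congr ((M `|` M0) _); rewrite rmorphD /=; ring.
  move=> q v [r Mv]; exists (q * r).
  by have := MZ q _ Mv; congr ((M `|` M0) _); rewrite rmorphM /=; ring.
have [q Bq] : B y.
  apply: contrapT => By; apply: (Mmax B); last by rewrite /P BE.
  split; last first.
    move=> /(_ x) BM; apply: Mx; left; apply: BM.
    by exists 1; rewrite rmorph1 mul1r subrr.
  by move=> v Mv; exists 0; rewrite rmorph0 mul0r subr0; left.
have q0 : ratr q != 0 :> F.
  by apply: contra_notN My => /eqP q0; move: Bq; rewrite q0 mul0r subr0.
exists q^-1; have := MZ (- q^-1) _ Bq; congr ((M `|` M0) _).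
by rewrite rmorphN /= fmorphV /=; field.
Qed.

(** The functional is the coordinate along [y] for the decomposition of [F] into Q [y] and a
    complement containing [M0]. *)
Lemma qfunctional M0 y : qsubspace M0 -> ~ M0 y ->
  exists l : F -> rat,
    [/\ {morph l : u v / u + v}, forall u, M0 u -> l u = 0 & l y = 1].
Proof.
move=> sM0 M0y; have [M [sM M0M My /choice [l lP]]] := maximal_qsubspace sM0 M0y.
have lE u q : M (u - ratr q * y) -> l u = q.
  move=> Mq; apply/eqP; rewrite -subr_eq0; apply: contra_notT My => lq.
  have := qsubspaceB sM Mq (lP u); case: sM => _ _ MZ /(MZ (l u - q)^-1).
  congr M; rewrite fmorphV rmorphB /=; field.
  by rewrite -rmorphB fmorph_eq0.
case: (sM) => M1 MD MZ; exists l; split.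
- move=> u v; apply: lE; have := MD _ _ (lP u) (lP v); congr M.
  by rewrite rmorphD /=; ring.
- by move=> u M0u; apply: lE; rewrite rmorph0 mul0r subr0; exact: M0M.
- by apply: lE; rewrite rmorph1 mul1r subrr.
Qed.

(** Multiply [e] by [t \o l], where [l] is a Q-linear functional killing [M0] with [l y = 1] and [t]
    is a homomorphism from Q to the units with [t 1 = z / e y]. *)
Lemma exponential_extension (e : F -> F) M0 y z :
    exponential e -> qsubspace M0 -> ~ M0 y -> z != 0 ->
  exists e', [/\ exponential e', forall u, M0 u -> e' u = e u & e' y = z].
Proof.
move=> expe sM0 M0y z0; have [l [lD l0 l1]] := qfunctional sM0 M0y.
have ey0 := exponential_neq0 y expe.
have [t [t1 tD]] := rat_hom (mulf_neq0 z0 (invr_neq0 ey0)).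
have t0 : t 0 = 1.
  have : t 1 != 0 by rewrite t1 mulf_neq0 ?invr_neq0.
  by move=> /mulfI; apply; rewrite -tD addr0 mulr1.
case: (sM0) => M00 _ _; have [e0 eD] := expe.
exists (fun u => e u * t (l u)); split.
- by split=> [|u v]; [rewrite l0 // t0 mulr1|rewrite lD eD tD; ring].
- by move=> u M0u; rewrite l0 // t0 mulr1.
- by rewrite l1 t1 mulrC divfK.
Qed.

End ExtendingExponentials.

(** * Number fields and algebraic numbers of large degree *)

Section NumberFields.
Implicit Types (K : set algC) (z : algC).

Definition number_field K :=
  exists (Qs : fieldExtType rat) (iota : {rmorphism Qs -> algC}), K = range iota.

Lemma number_field_seq (s : seq algC) :
  exists2 K, number_field K & forall z, z \in s -> K z.
Proof.
have [Qs [iota [s1 <- _]]] := num_field_exists s.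
exists (range iota); first by exists Qs, iota.
by move=> _ /mapP[x _ ->]; exists x.
Qed.

Section Closure.
Variables (K : set algC) (nfK : number_field K).

Lemma nf_rat q : K (ratr q).
Proof.
case: nfK => Qs [iota ->]; exists (in_alg Qs q) => //.
by rewrite [in_alg _ _]/(_ *: _) rmorphZ_num rmorph1 mulr1.
Qed.

Lemma nf0 : K 0. Proof. by rewrite -(rmorph0 (@ratr algC)); exact: nf_rat. Qed.
Lemma nf1 : K 1. Proof. by rewrite -(rmorph1 (@ratr algC)); exact: nf_rat. Qed.

Lemma nfD x y : K x -> K y -> K (x + y).
Proof.
case: nfK => Qs [iota ->] [a _ <-] [b _ <-].
by exists (a + b) => //; rewrite rmorphD.
Qed.

Lemma nfN x : K x -> K (- x).
Proof.
by case: nfK => Qs [iota ->] [a _ <-]; exists (- a) => //; rewrite rmorphN.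
Qed.

Lemma nfM x y : K x -> K y -> K (x * y).
Proof.
case: nfK => Qs [iota ->] [a _ <-] [b _ <-].
by exists (a * b) => //; rewrite rmorphM.
Qed.

Lemma nfV x : K x -> K x^-1.
Proof.
by case: nfK => Qs [iota ->] [a _ <-]; exists a^-1 => //; rewrite fmorphV.
Qed.

Lemma nfX x n : K x -> K (x ^+ n).
Proof.
move=> Kx; elim: n => [|n IH]; first exact: nf1.
by rewrite exprS; apply: nfM.
Qed.

Lemma nf_sum I (r : seq I) (P : pred I) (f : I -> algC) :
  (forall i, P i -> K (f i)) -> K (\sum_(i <- r | P i) f i).
Proof. by move=> Kf; elim/big_ind: _ => //; [exact: nf0|exact: nfD]. Qed.

Lemma nf_qsubspace : qsubspace K.
Proof. by split; [exact: nf0|exact: nfD|move=> q x; apply/nfM/nf_rat]. Qed.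

End Closure.

(** The new field is generated by [z] and the images of a Q-basis of the old one. *)
Lemma nf_adjoin K z : number_field K ->
  exists K', [/\ number_field K', K `<=` K' & K' z].
Proof.
move=> [Qs [iota ->]]; pose b := vbasis {:Qs}%VS.
have [K' nfK' bK'] := number_field_seq (z :: map iota b).
exists K'; split=> //; last by apply: bK'; rewrite mem_head.
move=> _ [a _ <-]; rewrite (coord_vbasis (memvf a)) rmorph_sum /=.
apply: nf_sum => // i _; rewrite rmorphZ_num; apply: nfM (nf_rat _ _) _ => //.
by apply: bK'; rewrite in_cons map_f ?orbT // mem_nth // size_tuple.
Qed.

(** The witness is a primitive p-th root of unity for a prime p > [d]: its minimal polynomial is
    cyclotomic, of size p. *)
Lemma large_degree d : exists2 z : algC, z != 0 &
  forall q : {poly rat}, (size q <= d)%N -> root (map_poly ratr q) z -> q = 0.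
Proof.
have [p pd pr_p] := prime_above d.
have [z prim_z] := C_prim_root_exists (prime_gt0 pr_p).
exists z.
  apply/eqP => z0; have := prim_expr_order prim_z.
  by rewrite z0 expr0n gtn_eqF ?prime_gt0 // => /eqP; rewrite eq_sym oner_eq0.
move=> q qd rq; have [m [mE mmon] mP] := minCpolyP z.
apply/eqP; apply: contraTT rq => q0; rewrite mP; apply/negP => /(dvdp_leq q0).
have := congr1 (fun r : {poly algC} => size r) mE.
rewrite (minCpoly_cyclotomic prim_z) size_cyclotomic totient_prime // size_map_poly => <-.
by rewrite prednK ?prime_gt0 // leqNgt (leq_ltn_trans qd).
Qed.

(* Modulo a polynomial of degree < N over a number field of degree d, the
   powers of a root are linear combinations of N * d elements over Q. *)
Lemma number_field_generic K N : number_field K ->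
  exists2 z : algC, z != 0 &
  forall p : {poly algC}, (forall i, K p`_i) -> (size p <= N)%N ->
    root p z -> p = 0.
Proof.
move=> [Qs [iota ->]]; set d := \dim {:Qs}; pose b := vbasis {:Qs}%VS.
have [z z0 zP] := large_degree (N * d).+1; exists z => // p pK pN rp.
have /choice [a aP] : forall i, exists a, iota a = p`_i.
  by move=> i; case: (pK i) => a _ <-; exists a.
pose p' := \poly_(i < size p) a i.
have p'E : map_poly iota p' = p.
  apply/polyP => i; rewrite coef_map coef_poly /=; case: ltnP => [_|ip]; first exact: aP.
  by rewrite rmorph0 nth_default.
have p's : size p' = size p by rewrite -p'E size_map_poly.
apply/eqP; apply: contraT => p0.
have p'0 : p' != 0 by rewrite -size_poly_gt0 p's size_poly_gt0.
pose r k := 'X^k %% p'.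
have rE k : z ^+ k = \sum_(i < N) iota (r k)`_i * z ^+ i.
  have /(congr1 (fun u => (map_poly iota u).[z])) := divp_eq 'X^k p'.
  rewrite map_polyXn hornerXn rmorphD rmorphM /= p'E hornerD hornerM.
  rewrite (rootP rp) mulr0 add0r => ->.
  rewrite (@horner_coef_wide _ N); last first.
    by rewrite size_map_poly (leq_trans _ pN) // -p's ltnW // ltn_modp.
  by apply: eq_bigr => i _; rewrite coef_map.
(* Row k lists the Q-coordinates of the coefficients of X^k modulo [p']. There is one row more than
   there are columns, so the rows are dependent; a dependency is a rational polynomial [q] vanishing
   at [z], too short for the degree of [z]. *)
pose A : 'M[rat]_((N * d).+1, N * d) :=
  \matrix_k mxvec (\matrix_(i < N, j < d) coord b j (r k)`_i).
have /rowV0Pn [c /sub_kermxP cA c0] : kermx A != 0.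
  rewrite -mxrank_eq0 mxrank_ker -lt0n subn_gt0.
  by rewrite (leq_ltn_trans (rank_leq_col A)).
pose q := \sum_(k < (N * d).+1) c 0 k *: 'X^k : {poly rat}.
have qk (k : 'I_(N * d).+1) : q`_k = c 0 k.
  rewrite coef_sum (bigD1 k) //= coefZ coefXn eqxx mulr1 big1 ?addr0 // => j jk.
  by rewrite coefZ coefXn eq_sym -[_ == _ :> nat]/(j == k) (negbTE jk) mulr0.
have /zP q0 : (size q <= (N * d).+1)%N.
  apply: (leq_trans (size_sum _ _ _)); apply/bigmax_leqP => k _.
  by rewrite (leq_trans (size_scale_leq _ _)) // size_polyXn.
suff /q0 q00 : root (map_poly ratr q) z.
  by case/eqP: c0; apply/rowP => k; rewrite -qk q00 coef0 mxE.
rewrite rootE; apply/eqP; rewrite rmorph_sum horner_sum /=.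
transitivity (\sum_(k < (N * d).+1) \sum_(i < N) iota (c 0 k *: (r k)`_i) * z ^+ i).
  apply: eq_bigr => k _; rewrite map_polyZ map_polyXn hornerZ hornerXn rE mulr_sumr.
  by apply: eq_bigr => i _; rewrite rmorphZ_num mulrA.
rewrite exchange_big big1 //= => i _; rewrite -mulr_suml -rmorph_sum /=.
suff -> : \sum_(k < (N * d).+1) c 0 k *: (r k)`_i = 0 by rewrite rmorph0 mul0r.
rewrite [LHS](coord_vbasis (memvf _)) big1 // => j _.
have /rowP /(_ (mxvec_index i j)) := cA; rewrite !mxE => cA0.
rewrite linear_sum -[RHS](scale0r b`_j); congr (_ *: _); rewrite -[RHS]cA0.
by apply: eq_bigr => k _; rewrite linearZ !mxE mxvecE mxE.
Qed.

End NumberFields.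

(** * Formal exponential polynomials over a tower of exponents *)

Section Towers.
Variables (F : numFieldType) (n : nat).

(* Level i of a tower has one variable more than level i - 1: for i < n it is
   X_i, with exponents in nat; for i >= n it is exp(g_i), with exponents in rat,
   where g_i, an element of the previous level, is recorded in the tower (the
   entries with i < n are dummies). An element of a level is an unreduced list of
   coefficients and exponents; it is formally zero when it satisfies [tnull]. *)
Definition expt (b : bool) : nmodType := if b then nat : nmodType else rat.

Fixpoint tpoly (r : nat) : choiceType :=
  if r is i.+1 then seq (tpoly i * expt (i < n)%N) else F.

Fixpoint tower (r : nat) : Type :=
  if r is i.+1 then (tower i * tpoly i)%type else unit.

Definition tzero r : tpoly r := if r is i.+1 then [::] else 0.

Definition tadd r : tpoly r -> tpoly r -> tpoly r :=
  if r is i.+1 return tpoly r -> tpoly r -> tpoly r then fun P Q => P ++ Q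
  else fun a b => a + b.

Fixpoint tscale (c : F) r : tpoly r -> tpoly r :=
  match r return tpoly r -> tpoly r with
  | 0 => fun a => c * a
  | i.+1 => fun P => [seq (tscale c a.1, a.2) | a <- P]
  end.

Fixpoint tmul r : tpoly r -> tpoly r -> tpoly r :=
  match r return tpoly r -> tpoly r -> tpoly r with
  | 0 => fun a b => a * b
  | i.+1 => fun P Q => [seq (tmul a.1 b.1, a.2 + b.2) | a <- P, b <- Q]
  end.

Definition tlift i (P : tpoly i) : tpoly i.+1 := [:: (P, 0)].

Fixpoint tconst (c : F) r : tpoly r :=
  if r is i.+1 then tlift (tconst c i) else c.

Definition tcoef i (k : expt (i < n)%N) (P : tpoly i.+1) : tpoly i :=
  foldr (@tadd i) (tzero i) [seq a.1 | a <- P & a.2 == k].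

Fixpoint tnull r : tpoly r -> Prop :=
  match r return tpoly r -> Prop with
  | 0 => fun a => a = 0
  | i.+1 => fun P => forall k, tnull (@tcoef i k P)
  end.

Lemma tnull_zero r : tnull (tzero r).
Proof. by elim: r => //= i IH k. Qed.

(* K + Q g_n + ... + Q g_(r - 1). *)
Fixpoint tspan (K : set F) r : tower r -> tpoly r -> Prop :=
  match r return tower r -> tpoly r -> Prop with
  | 0 => fun _ c => K c
  | i.+1 => fun T P => exists P' (q : rat),
      [/\ tspan K T.1 P', (i < n)%N -> q = 0 &
          P = tadd (tlift P') (tlift (tscale (ratr q) T.2))]
  end.

(** This is linear independence of the exponents g_n, g_(n + 1), ... over Q modulo constants: none
    differs by a formal zero from an element of the span of the constants and its predecessors. *)
Fixpoint tindep r : tower r -> Prop :=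
  match r return tower r -> Prop with
  | 0 => fun _ => True
  | i.+1 => fun T => tindep T.1 /\ ((n <= i)%N -> forall P,
      tspan setT T.1 P -> ~ tnull (tadd T.2 (tscale (-1) P)))
  end.

Lemma tspanS (K K' : set F) r (T : tower r) P :
  K `<=` K' -> tspan K T P -> tspan K' T P.
Proof.
move=> KK'; elim: r T P => [|i IH] /= T P; first exact: KK'.
by move=> [P' [q [sP' q0 ->]]]; exists P', q; split=> //; exact: IH.
Qed.

Section Bounds.
Variables (K : set F) (X : forall b, seq (expt b)).

(** With [K] a number field and [X] finite, the coefficients come from one number field and the
    exponents are bounded, so that a single generic point can serve for all these elements at
    once. *)
Fixpoint tbound r : tpoly r -> Prop :=
  match r return tpoly r -> Prop with
  | 0 => K
  | i.+1 => fun P : seq (tpoly i * expt (i < n)%N) =>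
      forall a, a \in P -> tbound a.1 /\ a.2 \in X (i < n)%N
  end.

Fixpoint tbounded r : tower r -> Prop :=
  match r return tower r -> Prop with
  | 0 => fun=> True
  | i.+1 => fun T => tbounded T.1 /\ tbound T.2
  end.

Hypotheses (K0 : K 0) (KD : forall a b, K a -> K b -> K (a + b)).
Hypotheses (KM : forall a b, K a -> K b -> K (a * b)) (Kq : forall q, K (ratr q)).
Hypothesis X0 : forall b, 0 \in X b.

Lemma tbound_zero r : tbound (tzero r).
Proof. by case: r => [|i a]; [exact: K0|rewrite in_nil]. Qed.

Lemma tbound_add r (P Q : tpoly r) : tbound P -> tbound Q -> tbound (tadd P Q).
Proof.
case: r P Q => [|i] P Q; first exact: KD.
by move=> bP bQ a; rewrite mem_cat => /orP[/bP|/bQ].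
Qed.

Lemma tbound_scale c r (P : tpoly r) : K c -> tbound P -> tbound (tscale c P).
Proof.
move=> Kc; elim: r P => [|i IH] P /=; first exact: KM.
by move=> bP _ /mapP[a /bP[ba aX] ->]; split=> //; exact: IH.
Qed.

Lemma tbound_lift i (P : tpoly i) : tbound P -> tbound (tlift P).
Proof. by move=> bP a; rewrite mem_seq1 => /eqP->; split=> //; exact: X0. Qed.

Lemma tbound_coef i k (P : tpoly i.+1) : tbound P -> tbound (@tcoef i k P).
Proof.
rewrite /tcoef; elim: P => [|a P IH] bP; first exact: tbound_zero.
have bP' : tbound (P : tpoly i.+1) by move=> b bb; apply: bP; rewrite in_cons bb orbT.
rewrite /=; case: eqP => _ /=; last exact: IH.
by apply: tbound_add (IH bP'); case: (bP a); rewrite ?mem_head.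
Qed.

Lemma tbound_span r (T : tower r) P : tbounded T -> tspan K T P -> tbound P.
Proof.
elim: r T P => [|i IH] // T P [bT bT2] [P' [q [sP' q0 ->]]].
apply: (@tbound_add i.+1); apply: tbound_lift; first exact: IH sP'.
exact: tbound_scale.
Qed.

Lemma tcoef_notin i (k : expt (i < n)%N) (P : tpoly i.+1) :
  tbound P -> k \notin X (i < n)%N -> tcoef k P = tzero i.
Proof.
move=> bP kX; rewrite /tcoef; elim: P bP => //= a P IH bP.
have [_ aX] := bP a (mem_head _ _).
have -> : (a.2 == k) = false by apply: contraNF kX => /eqP <-.
by apply: IH => b bb; apply: bP; rewrite in_cons bb orbT.
Qed.

End Bounds.

Lemma tboundS (K K' : set F) X X' r (P : tpoly r) :
    K `<=` K' -> (forall b, {subset X b <= X' b}) ->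
  tbound K X P -> tbound K' X' P.
Proof.
move=> KK' XX'; elim: r P => [|i IH] P /=; first exact: KK'.
by move=> bP a /bP[ba aX]; split; [exact: IH|exact: XX'].
Qed.

Lemma tboundedS (K K' : set F) X X' r (T : tower r) :
    K `<=` K' -> (forall b, {subset X b <= X' b}) ->
  tbounded K X T -> tbounded K' X' T.
Proof.
move=> KK' XX'; elim: r T => //= i IH T [bT bT2].
by split; [exact: IH|exact: tboundS bT2].
Qed.

Lemma tbound_exists r (P : tpoly r) :
  exists (s : seq F) (X : forall b, seq (expt b)), tbound [set` s] X P.
Proof.
elim: r P => [|i IH] P.
  by exists [:: P], (fun=> [::]); rewrite /= mem_head.
elim: P => [|a P [s1 [X1 b1]]]; first by exists [::], (fun=> [::]).
have [s2 [X2 b2]] := IH a.1.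
(* The list is indexed by the kind of exponent, whereas [a.2] has the kind of the present level; a
   cast records it for that kind, and the other kind gets nothing. *)
pose X3 b : seq (expt b) :=
  if (i < n)%N =P b is ReflectT ib then
    [:: ecast b (expt b) ib a.2] else [::].
exists (s1 ++ s2), (fun b => X1 b ++ X2 b ++ X3 b) => /= c.
have sub1 : [set` s1] `<=` [set` s1 ++ s2] by move=> z /= zs; rewrite mem_cat zs.
have sub2 : [set` s2] `<=` [set` s1 ++ s2] by move=> z /= zs; rewrite mem_cat zs orbT.
rewrite in_cons => /orP[/eqP->|/b1[bc cX]]; split.
- by apply: (tboundS sub2 _ b2) => b z zX; rewrite !mem_cat zX orbT.
- rewrite !mem_cat; apply/orP; right; apply/orP; right; rewrite /X3.
  case: eqP => [e|/(_ erefl)//].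
  by rewrite (eq_irrelevance e erefl) mem_head.
- by apply: (tboundS sub1 _ bc) => b z zX; rewrite !mem_cat zX.
- by rewrite mem_cat cX.
Qed.

Lemma tbounded_exists r (T : tower r) :
  exists (s : seq F) (X : forall b, seq (expt b)), tbounded [set` s] X T.
Proof.
elim: r T => [|i IH] T; first by exists [::], (fun=> [::]).
have [s1 [X1 b1]] := IH T.1; have [s2 [X2 b2]] := tbound_exists T.2.
have sub1 : [set` s1] `<=` [set` s1 ++ s2] by move=> z /= zs; rewrite mem_cat zs.
have sub2 : [set` s2] `<=` [set` s1 ++ s2] by move=> z /= zs; rewrite mem_cat zs orbT.
exists (s1 ++ s2), (fun b => X1 b ++ X2 b); split.
- by apply: (tboundedS sub1 _ b1) => b z zX; rewrite !mem_cat zX.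
- by apply: (tboundS sub2 _ b2) => b z zX; rewrite !mem_cat zX orbT.
Qed.

Section Evaluation.
Variables (R : comPzRingType) (E : R -> R) (phi : F -> R).

Definition tpow (x y : R) b : expt b -> R :=
  if b is true return expt b -> R then fun k => x ^+ k
  else fun q => E (phi (ratr q) * y).

Fixpoint teval (x : nat -> R) r : tower r -> tpoly r -> R :=
  match r return tower r -> tpoly r -> R with
  | 0 => fun _ => phi
  | i.+1 => fun T (P : seq _) =>
      \sum_(a <- P) teval x T.1 a.1 * tpow (x i) (teval x T.1 T.2) a.2
  end.
End Evaluation.

Lemma teval_congr (R : comPzRingType) (E : R -> R) (phi : F -> R) (x x' : nat -> R)
    r (T : tower r) :
  (forall i, (i < r)%N -> (i < n)%N -> x i = x' i) ->
  teval E phi x T =1 teval E phi x' T.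
Proof.
elim: r T => [|i IH] T xx' P //=.
have {}IH : teval E phi x T.1 =1 teval E phi x' T.1.
  by apply: IH => j ji; apply/xx'/ltnW.
apply: eq_bigr => a _; rewrite !IH; congr (_ * _).
by case: ltnP a.2 => //= ni k; rewrite xx'.
Qed.

Section EvaluationTheory.
Variables (R : comPzRingType) (E : R -> R) (phi : {rmorphism F -> R}).
Hypothesis expE : exponential E.
Variable x : nat -> R.
Local Notation tev := (teval E phi x).
Local Notation pw := (tpow E phi).

Lemma tpow0 (u v : R) b : pw u v (0 : expt b) = 1.
Proof.
by case: b => //=; rewrite !rmorph0 mul0r; case: expE.
Qed.

Lemma tpowD (u v : R) b (k l : expt b) : pw u v (k + l) = pw u v k * pw u v l.
Proof.
case: b k l => k l /=; first exact: exprD.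
by have [_ ED] := expE; rewrite -ED -mulrDl -rmorphD -rmorphD.
Qed.

Lemma teval_zero r (T : tower r) : tev T (tzero r) = 0.
Proof. by case: r T => [|i] T /=; [exact: rmorph0|rewrite big_nil]. Qed.

Lemma teval_add r (T : tower r) P Q : tev T (tadd P Q) = tev T P + tev T Q.
Proof. by case: r T P Q => [|i] T P Q /=; [exact: rmorphD|rewrite big_cat]. Qed.

Lemma teval_scale r (T : tower r) c P : tev T (tscale c P) = phi c * tev T P.
Proof.
elim: r T P => [|i IH] T P /=; first exact: rmorphM.
by rewrite big_map mulr_sumr; apply: eq_bigr => a _; rewrite IH mulrA.
Qed.

Lemma teval_mul r (T : tower r) P Q : tev T (tmul P Q) = tev T P * tev T Q.
Proof.
elim: r T P Q => [|i IH] T P Q /=; first exact: rmorphM.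
rewrite big_allpairs_dep mulr_suml; apply: eq_bigr => a _.
by rewrite mulr_sumr; apply: eq_bigr => b _; rewrite IH tpowD mulrACA.
Qed.

Lemma teval_lift i (T : tower i.+1) (P : tpoly i) : tev T (tlift P) = tev T.1 P.
Proof. by rewrite /= big_seq1 tpow0 mulr1. Qed.

Lemma teval_const r (T : tower r) c : tev T (tconst c r) = phi c.
Proof. by elim: r T => // i IH T; rewrite [tconst _ _]/(tlift _) teval_lift. Qed.

(** Collecting equal exponents turns the unreduced list into a sum over distinct exponents, to which
    [Xs] may add some that do not occur. *)
Lemma teval_coef i (T : tower i.+1) (P : tpoly i.+1) (Xs : seq (expt (i < n)%N)) :
    uniq Xs -> (forall k, k \notin Xs -> tcoef k P = tzero i) ->
  tev T P = \sum_(k <- Xs) tev T.1 (tcoef k P) * pw (x i) (tev T.1 T.2) k.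
Proof.
move=> uX PX.
have coefE k : tev T.1 (tcoef k P) = \sum_(a <- P | a.2 == k) tev T.1 a.1.
  rewrite /tcoef; elim: (P : seq _) => [|a Q IH] /=; first by rewrite big_nil teval_zero.
  by rewrite big_cons; case: eqP => _ //=; rewrite teval_add IH.
pose Ys := undup (Xs ++ [seq a.2 | a <- P]).
transitivity (\sum_(k <- Ys) tev T.1 (tcoef k P) * pw (x i) (tev T.1 T.2) k).
  rewrite /=; under [RHS]eq_bigr do rewrite coefE mulr_suml big_mkcond.
  rewrite exchange_big /= !big_seq; apply: eq_bigr => a aP.
  rewrite (bigD1_seq a.2) ?undup_uniq //=; last first.
    by rewrite mem_undup mem_cat map_f ?orbT.
  rewrite eqxx big1 ?addr0 // => k; rewrite eq_sym => /negbTE -> //.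
rewrite (bigID (mem Xs)) /= [X in _ + X]big1 ?addr0; last first.
  by move=> k /PX ->; rewrite teval_zero mul0r.
rewrite -big_filter; apply/perm_big/uniq_perm; rewrite ?filter_uniq ?undup_uniq //.
by move=> k; rewrite mem_filter mem_undup mem_cat; case: (k \in Xs).
Qed.

Lemma teval_null r (T : tower r) P : tnull P -> tev T P = 0.
Proof.
elim: r T P => [|i IH] T P /=; first by move=> ->; exact: rmorph0.
move=> nP; rewrite -[LHS]/(tev T (P : tpoly i.+1)).
have [s [X bP]] := tbound_exists (P : tpoly i.+1).
rewrite (@teval_coef _ _ _ (undup (X (i < n)%N))) ?undup_uniq //.
  by rewrite big1_seq // => k _; rewrite IH ?mul0r.
by move=> k; rewrite mem_undup => /(tcoef_notin bP).
Qed.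

Lemma tspan_const (K : set F) c r (T : tower r) : K c ->
  exists P, tspan K T P /\ tev T P = phi c.
Proof.
move=> Kc; elim: r T => [|i IH] T; first by exists c.
have [P [sP vP]] := IH T.1; exists (tadd (tlift P) (tlift (tscale (ratr 0) T.2))).
split; first by exists P, 0.
by rewrite teval_add !teval_lift teval_scale !rmorph0 mul0r addr0.
Qed.

End EvaluationTheory.

Lemma teval_morph (R S : comPzRingType) (E : R -> R) (E' : S -> S)
    (phi : F -> R) (psi : F -> S) (h : R -> S) x r (T : tower r) P :
    h 0 = 0 -> {morph h : a b / a + b} -> h 1 = 1 -> {morph h : a b / a * b} ->
    (forall a, h (E a) = E' (h a)) -> (forall c, h (phi c) = psi c) ->
  h (teval E phi x T P) = teval E' psi (h \o x) T P.
Proof.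
move=> h0 hD h1 hM hE hphi; elim: r T P => [|i IH] T P //=.
rewrite (big_morph h hD h0); apply: eq_bigr => a _; rewrite hM IH; congr (_ * _).
case: (i < n)%N a.2 => k /=; last by rewrite hE hM hphi IH.
by elim: k => [|k IHk]; rewrite ?expr0 // !exprS hM IHk.
Qed.

End Towers.

(** * Generic values of the variables of a tower *)

Section ExponentPolynomial.
Variables (R : nzRingType) (T : eqType) (Xs : seq T) (f : T -> nat) (c : T -> R).
Hypotheses (uX : uniq Xs) (f_inj : {in Xs &, injective f}).

(** The map [f] turns possibly rational exponents into natural ones, so that an element of a level
    becomes a polynomial in one variable. *)
Definition exponent_poly : {poly R} := \sum_(k <- Xs) c k *: 'X^(f k).

Lemma coef_exponent_poly k : k \in Xs -> exponent_poly`_(f k) = c k.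
Proof.
move=> kX; rewrite coef_sum (bigD1_seq k) //= coefZ coefXn eqxx mulr1.
rewrite big_seq_cond big1 ?addr0 // => j /andP[jX jk]; rewrite coefZ coefXn.
by rewrite (inj_in_eq f_inj) // eq_sym (negbTE jk) mulr0.
Qed.

Lemma size_exponent_poly : (size exponent_poly <= (\max_(k <- Xs) f k).+1)%N.
Proof.
rewrite /exponent_poly; elim/big_ind2: _ => [|p a q b pa qb|k _].
- by rewrite size_poly0.
- rewrite (leq_trans (size_polyD _ _)) // geq_max.
  by rewrite (leq_trans pa) ?(leq_trans qb) // ltnS ?leq_maxl ?leq_maxr.
- by rewrite (leq_trans (size_scale_leq _ _)) // size_polyXn.
Qed.

End ExponentPolynomial.

Lemma horner_exponent_poly (R : comNzRingType) (T : eqType) (Xs : seq T) f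
    (c : T -> R) z :
  (exponent_poly Xs f c).[z] = \sum_(k <- Xs) c k * z ^+ f k.
Proof. by rewrite horner_sum; apply: eq_bigr => k _; rewrite hornerZ hornerXn. Qed.

(** [f q] is the numerator of [q] over a common denominator [m], shifted by [N] to make it a natural
    number. *)
Lemma common_denominator (Xs : seq rat) : exists m N (f : rat -> nat),
  (0 < m)%N /\ {in Xs, forall q, q * m%:R = (f q)%:R - N%:R}.
Proof.
elim: Xs => [|q Xs [m [N [f [m0 fP]]]]]; first by exists 1%N, 0%N, (fun=> 0%N).
pose d := `|denq q|%N; have d0 : (0 < d)%N by rewrite absz_gt0 denq_neq0.
have qd : q * d%:R = (numq q)%:~R by exact: mulq_denq.
pose a := `|numq q|%N.
(* The new denominator is [m * d], where [q] has numerator [numq q * m]; the extra shift [a * m]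
   compensates a negative [numq q]. *)
pose fq := numq q * m%:Z + a%:Z * m%:Z + N%:Z * d%:Z.
exists (m * d)%N, (N * d + a * m)%N, (fun r => if r == q then `|fq|%N
  else (f r * d + a * m)%N).
split=> [|r]; first by rewrite muln_gt0 m0.
have ge0 : 0 <= fq.
  by rewrite /fq -mulrDl addr_ge0 // mulr_ge0 // /a; lia.
rewrite in_cons; case: eqP => [-> _|_ /= /fP rE].
  rewrite natr_absz ger0_norm // mulnC natrM mulrA qd.
  by rewrite !natrD !intrD !intrM !natrM -!pmulrn; ring.
by rewrite natrM mulrA rE !natrD !natrM; ring.
Qed.

Section Genericity.
Variable n : nat.
Implicit Types (e : algC -> algC) (x : nat -> algC) (K : set algC).
Implicit Types (X : forall b, seq (expt b)).
Local Notation tpoly := (tpoly algC n).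
Local Notation tower := (tower algC n).
Local Notation tev e := (teval (n := n) e idfun).

(* When [e] is modified outside [tvalues K e x T], evaluation at x in the tower
   does not change. *)
Definition tvalues K e x r (T : tower r) : set algC :=
  [set z | exists2 P, tspan K T P & z = tev e x T P].

Section Values.
Variables (K : set algC) (e : algC -> algC) (x : nat -> algC).
Hypotheses (qK : qsubspace K) (expe : exponential e).

Lemma tvalues_const r (T : tower r) : K `<=` tvalues K e x T.
Proof.
by move=> c Kc; have [P [sP vP]] := tspan_const idfun expe x T Kc; exists P.
Qed.

Lemma tvaluesS i (T : tower i.+1) : tvalues K e x T.1 `<=` tvalues K e x T.
Proof.
move=> _ [P sP ->]; exists (tadd (tlift P) (tlift (tscale (ratr 0) T.2))).
  by exists P, 0.
by rewrite teval_add !teval_lift // teval_scale !rmorph0 mul0r addr0.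
Qed.

Lemma tvalues_exponent i (T : tower i.+1) q : (n <= i)%N ->
  tvalues K e x T (ratr q * tev e x T.1 T.2).
Proof.
move=> ni; have [K0 _ _] := qK; have [P [sP vP]] := tspan_const idfun expe x T.1 K0.
exists (tadd (tlift P) (tlift (tscale (ratr q) T.2))).
  by exists P, q; split=> //; rewrite ltnNge ni.
by rewrite teval_add !teval_lift // teval_scale vP /= add0r.
Qed.

Lemma tvalues_qsubspace r (T : tower r) : qsubspace (tvalues K e x T).
Proof.
have [K0 KD KZ] := qK; split; first exact: tvalues_const.
- move=> u v [P sP ->] [Q sQ ->]; elim: r T P Q sP sQ => [|i IH] T P Q.
    by move=> /= KP KQ; exists (P + Q); [exact: KD|].
  move=> [P' [p [sP p0 ->]]] [Q' [q [sQ q0 ->]]]; have [S sS vS] := IH _ _ _ sP sQ.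
  exists (tadd (tlift S) (tlift (tscale (ratr (p + q)) T.2))).
    by exists S, (p + q); split=> // ni; rewrite p0 ?q0.
  by rewrite !teval_add !teval_lift // !teval_scale -vS /= rmorphD; ring.
- move=> c u [P sP ->]; elim: r T P sP => [|i IH] T P.
    by move=> /= KP; exists (ratr c * P); [exact: KZ|].
  move=> [P' [p [sP p0 ->]]]; have [S sS vS] := IH _ _ sP.
  exists (tadd (tlift S) (tlift (tscale (ratr (c * p)) T.2))).
    by exists S, (c * p); split=> // ni; rewrite p0 ?mulr0.
  by rewrite !teval_add !teval_lift // !teval_scale mulrDr -vS /= rmorphM; ring.
Qed.

Lemma teval_local e' r (T : tower r) :
  (forall z, tvalues K e x T z -> e' z = e z) -> tev e' x T =1 tev e x T.
Proof.
elim: r T => [|i IH] T ee' P //=.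
have {}IH : tev e' x T.1 =1 tev e x T.1 by apply: IH => z /tvaluesS; exact: ee'.
apply: eq_bigr => a _; rewrite !IH; congr (_ * _).
case: ltnP a.2 => // ni q /=; exact/ee'/tvalues_exponent.
Qed.

(** A zero found at one stage of the construction survives to the limit once the finitely many
    values of [e] entering its evaluation are fixed. *)
Lemma teval_finite r (T : tower r) P : exists s : seq algC,
  forall e', {in s, e' =1 e} -> tev e' x T P = tev e x T P.
Proof.
elim: r T P => [|i IH] T P; first by exists [::].
have [s2 s2P] := IH T.1 T.2.
elim: P => [|a P [s sP]]; first by exists [::] => e' _; rewrite /= !big_nil.
have [s1 s1P] := IH T.1 a.1.
have [s3 s3P] : exists s3 : seq algC, forall e', {in s3, e' =1 e} ->
    tpow e' idfun (x i) (tev e x T.1 T.2) a.2 = tpow e idfun (x i) (tev e x T.1 T.2) a.2.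
  case: (i < n)%N a.2 => k; first by exists [::].
  by exists [:: ratr k * tev e x T.1 T.2] => e' /(_ _ (mem_head _ _)).
exists (s ++ s1 ++ s2 ++ s3) => e' e'E; rewrite /= !big_cons.
have sub (t : seq algC) : {subset t <= s ++ s1 ++ s2 ++ s3} -> {in t, e' =1 e}.
  by move=> st z /st; exact: e'E.
have e's := sP e' (sub s _); rewrite /= in e's.
rewrite e's; last by move=> z zs; rewrite !mem_cat zs ?orbT.
by rewrite s1P ?s2P ?s3P //; apply: sub => z zs; rewrite !mem_cat zs ?orbT.
Qed.

End Values.

Lemma exponential_natmul (F : comPzRingType) (E : F -> F) (y : F) k :
  exponential E -> E (k%:R * y) = E y ^+ k.
Proof.
move=> [E0 ED]; elim: k => [|k IH]; first by rewrite mul0r E0 expr0.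
by rewrite -natr1 mulrDl mul1r ED IH exprSr.
Qed.

(** For a common denominator [m] of [Xs], prescribe the value [z] at [y / m]. The value at [q y] is
    then z^(q m), and the factor z^N clears negative exponents. *)
Lemma exponential_prescribe e (D : set algC) y (Xs : seq rat) :
    exponential e -> qsubspace D -> ~ D y ->
  exists N (f : rat -> nat), {in Xs &, injective f} /\
    forall z, z != 0 -> exists e',
      [/\ exponential e', forall u, D u -> e' u = e u &
          {in Xs, forall q, z ^+ N * e' (ratr q * y) = z ^+ f q}].
Proof.
move=> expe qD Dy; have [m [N [f [m0 fP]]]] := common_denominator Xs.
have m0' : m%:R != 0 :> algC by rewrite pnatr_eq0 -lt0n.
exists N, f; split=> [q r qX rX fqr|z z0].
  have m0q : m%:R != 0 :> rat by rewrite pnatr_eq0 -lt0n.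
  by apply: (mulIf m0q); rewrite !fP // fqr.
have Dy' : ~ D (y / m%:R).
  case: qD => _ _ DZ /(DZ m%:R); rewrite ratr_nat mulrC divfK //.
have [e' [expe' e'D e'y]] := exponential_extension expe qD Dy' z0.
exists e'; split=> // q qX; have [_ e'A] := expe'.
rewrite -e'y -!exponential_natmul // -e'A; congr (e' _).
have /(congr1 (@ratr algC)) := fP q qX.
rewrite rmorphM rmorphB /= !ratr_nat => qE.
have -> : ratr q * y = (ratr q * m%:R) * (y / m%:R) by field.
by rewrite qE; ring.
Qed.

Definition generic_values K X K' e x r (T : tower r) := forall P,
  tbound K X P -> K' (tev e x T P) /\ (tev e x T P = 0 -> tnull P).

(** If the value of the exponent lay in the span of the earlier ones, the difference of the two
    formal elements would vanish at [x], hence formally by genericity, against [tindep]. So exp can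
    be prescribed at its rational multiples without disturbing the lower levels. *)
Lemma exponent_notin K X K' e x i (T : tower i.+1) :
    number_field K -> (forall b, 0 \in X b) -> exponential e -> (n <= i)%N ->
    tbounded K X T -> tindep T -> generic_values K X K' e x T.1 ->
  ~ tvalues K e x T.1 (tev e x T.1 T.2).
Proof.
move=> nfK X0 expe ni [bT bT2] [_ /(_ ni) indT] gT [P sP vP].
have KN1 : K (-1) by have := nfN nfK (nf1 nfK).
apply: (indT P (tspanS (@subsetT _ K) sP)).
have [|_] := gT (tadd T.2 (tscale (-1) P)).
  apply: tbound_add => //; first exact: nfD nfK.
  apply: tbound_scale => //; first exact: nfM nfK.
  by apply: tbound_span bT sP => //; [exact: nfD nfK|exact: nfM nfK|exact: nf_rat nfK].
by apply; rewrite teval_add teval_scale -vP rmorphN1 mulN1r subrr.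
Qed.

(* If the value of the last variable is generic enough over the number field
   K1, then so are the values at the next level. *)
Lemma generic_step K X K1 K2 e x i (T : tower i.+1) N z u (f : expt (i < n)%N -> nat) :
    number_field K -> number_field K2 -> exponential e -> K1 `<=` K2 ->
    generic_values K X K1 e x T.1 ->
    (forall p : {poly algC}, (forall i, K1 p`_i) -> (size p <= N)%N ->
       root p z -> p = 0) ->
    K1 0 -> {in X (i < n)%N &, injective f} ->
    (\max_(k <- undup (X (i < n)%N)) f k < N)%N -> u != 0 ->
    {in X (i < n)%N, forall k, K2 (tpow e idfun (x i) (tev e x T.1 T.2) k) /\
      u * tpow e idfun (x i) (tev e x T.1 T.2) k = z ^+ f k} ->
  generic_values K X K2 e x T.
Proof.
move=> nfK nfK2 expe K12 gT zP K10 f_inj fN u0 powP P bP.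
set X' := undup (X (i < n)%N) in fN.
have uX' : uniq X' by exact: undup_uniq.
have X'E k : (k \in X') = (k \in X (i < n)%N) by rewrite mem_undup.
have bc k : tbound K X (tcoef k P) by apply: tbound_coef bP; [exact: nf0 nfK|exact: nfD nfK].
have PE := teval_coef e idfun x T (P := P) uX'.
have {}PE : tev e x T P = \sum_(k <- X') tev e x T.1 (tcoef k P) *
    tpow e idfun (x i) (tev e x T.1 T.2) k.
  by apply: PE => k; rewrite X'E => /(tcoef_notin bP).
split=> [|P0].
  rewrite PE big_seq; apply: (nf_sum nfK2) => k; rewrite X'E => /powP[Kk _].
  by apply: nfM => //; apply/K12; case: (gT _ (bc k)).
pose p := exponent_poly X' f (fun k => tev e x T.1 (tcoef k P)).
have f_inj' : {in X' &, injective f} by move=> k l; rewrite !X'E; exact: f_inj.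
have p0 : p = 0.
  apply: zP; last first.
  - rewrite rootE horner_exponent_poly; apply/eqP.
    transitivity (u * tev e x T P); last by rewrite P0 mulr0.
    rewrite PE mulr_sumr.
    by apply: eq_big_seq => k; rewrite X'E => /powP[_ <-]; rewrite mulrCA.
  - exact: leq_trans (size_exponent_poly _ _ _) fN.
  - move=> j; have [/hasP[k kX /eqP <-]|/hasPn jX] := boolP (has (fun k => f k == j) X').
      by rewrite coef_exponent_poly //; case: (gT _ (bc k)).
    rewrite coef_sum big_seq big1 // => k /jX.
    by rewrite coefZ coefXn eq_sym => /negbTE->; rewrite mulr0.
move=> k; have [kX|kX] := boolP (k \in X').
  have [_] := gT _ (bc k); apply.
  have := coef_exponent_poly (fun k => tev e x T.1 (tcoef k P)) uX' f_inj' kX.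
  by rewrite -/p p0 coef0.
by rewrite (tcoef_notin bP) -?X'E //; exact: tnull_zero.
Qed.

(** The Boolean [i < n] does not compute for variable [i]; this map and [expt_rat] read an exponent
    at a known type, with a dummy value for the other kind. *)
Definition expt_nat b : expt b -> nat :=
  if b is true return expt b -> nat then id else fun=> 0%N.

Definition expt_rat b : expt b -> rat :=
  if b is true return expt b -> rat then fun=> 0 else id.

Lemma expt_nat_inj (b : bool) : b -> injective (@expt_nat b).
Proof. by case: b => //= _ k l. Qed.

Lemma expt_rat_inj (b : bool) : ~~ b -> injective (@expt_rat b).
Proof. by case: b => //= _ k l. Qed.

Lemma tpow_nat (R : comPzRingType) E (phi : algC -> R) (u v : R) (b : bool) (k : expt b) :
  b -> tpow E phi u v k = u ^+ expt_nat k.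
Proof. by case: b k. Qed.

Lemma tpow_rat (R : comPzRingType) E (phi : algC -> R) (u v : R) (b : bool) (k : expt b) :
  ~~ b -> tpow E phi u v k = E (phi (ratr (expt_rat k)) * v).
Proof. by case: b k. Qed.

Lemma generic_values_local K X K' e x e' x' r (T : tower r) :
    tev e' x' T =1 tev e x T ->
  generic_values K X K' e x T -> generic_values K X K' e' x' T.
Proof. by move=> ee gT P bP; rewrite ee; exact: gT. Qed.

(** Level by level, choose [z] of large degree over the number field reached so far. It becomes the
    value of [X_i], or, at an exponential level, the value of a modified exponential at a fraction
    of the exponent; the modification leaves [K] and the lower levels unchanged. *)
Lemma tower_generic e K X r (T : tower r) :
    exponential e -> number_field K -> (forall b, 0 \in X b) ->
    tbounded K X T -> tindep T ->
  exists e' x K', [/\ exponential e', forall z, K z -> e' z = e z,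
    number_field K', K `<=` K' & generic_values K X K' e' x T].
Proof.
move=> expe nfK X0; elim: r T => [|i IH] T bT indT.
  by exists e, (fun=> 0), K; split=> // c Kc; split.
have [bT1 bT2] := bT; have [indT1 _] := indT.
have [e1 [x [K1 [expe1 e1K nfK1 KK1 gT]]]] := IH _ bT1 indT1.
have K10 := nf0 nfK1.
pose X' := undup (X (i < n)%N).
have [ni|ni] := boolP (i < n)%N.
  pose N := (\max_(k <- X') expt_nat k).+1.
  have [z z0 zP] := number_field_generic N nfK1.
  have [K2 [nfK2 K12 K2z]] := nf_adjoin z nfK1.
  pose x2 j := if j == i then z else x j.
  have x2E : tev e1 x2 T.1 =1 tev e1 x T.1.
    by apply: teval_congr => j ji _; rewrite /x2 ltn_eqF.
  exists e1, x2, K2; split=> //; first by move=> c /KK1 /K12.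
  apply: (@generic_step K X K1 K2 e1 x2 i T N z 1 (@expt_nat _)) => //.
  - exact: generic_values_local gT.
  - by move=> k l _ _; exact: expt_nat_inj.
  - exact: oner_neq0.
  - move=> k _; rewrite mul1r tpow_nat // /x2 eqxx; split=> //.
    exact: nfX.
have ni' : (n <= i)%N by rewrite leqNgt.
have yP := exponent_notin nfK X0 expe1 ni' bT indT gT.
have qK := nf_qsubspace nfK; have qD := tvalues_qsubspace x qK expe1 T.1.
have [N0 [f [f_inj eP]]] :=
  exponential_prescribe [seq expt_rat k | k <- X (i < n)%N] expe1 qD yP.
pose g (k : expt (i < n)%N) := f (expt_rat k).
have [z z0 zP] := number_field_generic (\max_(k <- X') g k).+1 nfK1.
have [K2 [nfK2 K12 K2z]] := nf_adjoin z nfK1.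
have [e2 [expe2 e2D e2z]] := eP z z0.
have e2E : tev e2 x T.1 =1 tev e1 x T.1 by apply: (teval_local qK expe1).
have KD := @tvalues_const K e1 x expe1 i T.1.
exists e2, x, K2; split=> //; first by move=> c Kc; rewrite e2D ?e1K //; exact: KD.
  by move=> c /KK1 /K12.
apply: (@generic_step K X K1 K2 e2 x i T _ z (z ^+ N0) g nfK nfK2 expe2 K12 _ zP) => //.
- exact: generic_values_local gT.
- move=> k l kX lX /f_inj; rewrite !map_f // => /(_ isT isT).
  exact: (@expt_rat_inj _ ni).
- by rewrite expf_neq0.
- move=> k kX; rewrite tpow_rat // e2E /= e2z ?map_f //; split=> //.
  have -> : e2 (ratr (expt_rat k) * tev e1 x T.1 T.2) = z ^+ g k / z ^+ N0.
    by apply: (canRL (mulfK _)); rewrite ?expf_neq0 // mulrC e2z ?map_f.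
  by apply: nfM => //; [exact: nfX|apply: nfV => //; exact: nfX].
Qed.

End Genericity.

Lemma expoly_const_zmod (F : fieldType) (e : F -> F) n :
  zmod_morphism (expoly_const e n).
Proof.
have cD := @expoly_constD F e n; move=> a b; apply/eqP.
by rewrite eq_sym subr_eq -cD subrK.
Qed.

Lemma expoly_const_monoid (F : fieldType) (e : F -> F) n :
  monoid_morphism (expoly_const e n).
Proof. by split=> //; exact: expoly_constM. Qed.

HB.instance Definition _ (F : fieldType) (e : F -> F) n :=
  GRing.isZmodMorphism.Build F (expoly e n) (expoly_const e n)
    (expoly_const_zmod e n).
HB.instance Definition _ (F : fieldType) (e : F -> F) n :=
  GRing.isMonoidMorphism.Build F (expoly e n) (expoly_const e n)
    (expoly_const_monoid e n).

(** Having two terms, [p] is not a monomial. Dividing out the highest power of X leaves a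
    nonconstant factor that does not vanish at 0, and any root of it will do. *)
Lemma root_neq0 (F : closedFieldType) (p : {poly F}) a b :
  a != b -> p`_a != 0 -> p`_b != 0 -> exists2 z, z != 0 & root p z.
Proof.
move=> ab pa pb; have p0 : p != 0 by apply: contraNneq pa => ->; rewrite coef0.
have [m [q + pE]] := multiplicity_XsubC p 0; rewrite p0 /= => q0.
have [sq|/closed_rootP[z qz]] := eqVneq (size q) 1%N.
  have [c c0 qE] : exists2 c, c != 0 & q = c%:P by apply/size_poly1P/eqP.
  have pk k : p`_k != 0 -> k = m.
    by rewrite pE qE polyC0 subr0 coefCM coefXn; case: (k =P m); rewrite ?mulr0 ?eqxx.
  by case/eqP: ab; transitivity m; [exact: pk|exact/esym/pk].
exists z; first by apply: contraNneq q0 => <-.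
by rewrite pE rootM qz.
Qed.

(** * Zeros of exponential polynomials *)

Section Solving.
Variable n : nat.
Implicit Types (e : algC -> algC) (x : nat -> algC) (K : set algC) (s : seq algC).
Local Notation tpoly := (tpoly algC n).
Local Notation tower := (tower algC n).
Local Notation tev e := (teval (n := n) e idfun).

Definition expoly_vars e (i : nat) : expoly e n :=
  if insub i is Some j then expoly_var e j else 0.

(** The exponential polynomial represented by a tower element, obtained by evaluating in
    [expoly e n] at its own variables. *)
Definition tterm e r (T : tower r) : tpoly r -> expoly e n :=
  teval (@expoly_exp _ e n) (expoly_const e n) (expoly_vars e) T.

Lemma common_bounds r (T : tower r) (P : tpoly r) s :
  exists K (X : forall b, seq (expt b)),
    [/\ number_field K, forall b, 0 \in X b, tbounded K X T, tbound K X P &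
        forall z, z \in s -> K z].
Proof.
have [s1 [X1 b1]] := tbounded_exists T; have [s2 [X2 b2]] := tbound_exists P.
have [K nfK sK] := number_field_seq (s1 ++ s2 ++ s).
exists K, (fun b => 0 :: X1 b ++ X2 b); split=> //.
- by move=> b; rewrite mem_head.
- apply: tboundedS b1 => [z zs|b z zX]; first by apply: sK; rewrite mem_cat zs.
  by rewrite in_cons mem_cat zX orbT.
- apply: tboundS b2 => [z zs|b z zX]; first by apply: sK; rewrite !mem_cat zs orbT.
  by rewrite in_cons mem_cat zX !orbT.
- by move=> z zs; apply: sK; rewrite !mem_cat zs !orbT.
Qed.

Lemma teval_single (R : comPzRingType) (E : R -> R) (phi : {rmorphism algC -> R})
    (x : nat -> R) i (T : tower i.+1) (P : tpoly i.+1) k :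
    exponential E -> (forall l, l != k -> tnull (tcoef l P)) ->
  teval E phi x T P = teval E phi x T.1 (tcoef k P) *
    tpow E phi (x i) (teval E phi x T.1 T.2) k.
Proof.
move=> expE nP; have [s [X bP]] := tbound_exists P.
rewrite (@teval_coef _ _ _ _ _ _ _ _ _ (undup (k :: X (i < n)%N))) ?undup_uniq //.
  rewrite (bigD1_seq k) ?undup_uniq ?mem_undup ?mem_head //= big1 ?addr0 // => l lk.
  by rewrite teval_null ?mul0r //; exact: nP.
move=> l; rewrite mem_undup in_cons negb_or => /andP[_ lX].
exact: tcoef_notin bP lX.
Qed.

Definition zero_or_exp e r (T : tower r) P :=
  (exists x, tev e x T P = 0) \/ (exists u, tterm e T P = expoly_exp u).

(** A forcing condition: the finitely many values of [e'] on [s'] settle the alternative for every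
    later exponential, in particular for the limit. *)
Definition stabilizes e s r (T : tower r) P := exists e' s',
  [/\ exponential e', {in s, e' =1 e}, {subset s <= s'} &
      forall e'', ELA_field e'' -> {in s', e'' =1 e'} -> zero_or_exp e'' T P].

Lemma stabilizes_zero e s r (T : tower r) P e' x :
    exponential e' -> {in s, e' =1 e} -> tev e' x T P = 0 ->
  stabilizes e s T P.
Proof.
move=> expe' e'e P0; have [s' s'P] := teval_finite e' x T P.
exists e', (s ++ s'); split=> //; first by move=> z zs; rewrite mem_cat zs.
move=> e'' _ e''e'; left; exists x; rewrite s'P // => z zs.
by apply: e''e'; rewrite mem_cat zs orbT.
Qed.

(* An element in which the last variable occurs properly has a zero at which
   the other variables take generic values; otherwise the last variable can be
   factored out. *)
Lemma solve e s r (T : tower r) P :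
  exponential e -> tindep T -> stabilizes e s T P.
Proof.
move=> expe; elim: r T P => [|i IH] T P indT.
  have [P0|P0] := eqVneq (P : algC) 0.
    exact: (@stabilizes_zero _ _ _ _ _ e (fun=> 0)).
  (* A nonzero constant is an exponential because [e''] is surjective onto the nonzero elements. *)
  exists e, s; split=> // e'' [_ _ /(_ _ P0)[a ea]] _; right.
  by exists (expoly_const e'' n a); rewrite -expoly_constE ea.
have [indT1 _] := indT; have [K [X [nfK X0 bT bP sK]]] := common_bounds T P s.
have [bT1 bT2] := bT.
have [e1 [x [K1 [expe1 e1K nfK1 KK1 gT]]]] := tower_generic expe nfK X0 bT1 indT1.
have bc k : tbound K X (tcoef k P).
  by apply: tbound_coef bP; [exact: nf0 nfK|exact: nfD nfK].
pose X' := undup (X (i < n)%N); have uX' : uniq X' by exact: undup_uniq.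
have X'P k : k \notin X' -> tcoef k P = tzero _ _ i.
  by rewrite mem_undup; exact: (tcoef_notin bP).
have cX' k : ~ tnull (tcoef k P) -> k \in X'.
  by move=> ck; apply: contra_notT ck => /X'P ->; exact: tnull_zero.
pose c k := tev e1 x T.1 (tcoef k P).
have c0 k : ~ tnull (tcoef k P) -> c k != 0.
  by move=> ck; apply: contra_notN ck => /eqP; case: (gT _ (bc k)).
have expR e'' : exponential (@expoly_exp _ e'' n) by exact: expoly_exponential.
have [ni|ni] := boolP (i < n)%N.
  (* The variable X_i may take the value 0, so one term of positive degree is enough to find a
     root. *)
  have [[k [k0 nk]]|noc] := pselect (exists k, k != 0 /\ ~ tnull (tcoef k P)).
    pose p := exponent_poly X' (@expt_nat _) c.
    have f_inj : {in X' &, injective (@expt_nat (i < n)%N)}.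
      by move=> a b _ _; exact: expt_nat_inj.
    have [z pz] : exists z, root p z.
      apply/closed_rootP/negP => /eqP p1.
      have := coef_exponent_poly c uX' f_inj (cX' _ nk); rewrite -/p nth_default.
        by move/esym/eqP; rewrite (negbTE (c0 _ nk)).
      rewrite p1 lt0n; apply: contra k0 => /eqP k0; apply/eqP.
      by apply: (expt_nat_inj ni); rewrite k0; case: (i < n)%N ni.
    pose x2 j := if j == i then z else x j.
    have x2E : tev e1 x2 T.1 =1 tev e1 x T.1.
      by apply: teval_congr => j ji _; rewrite /x2 ltn_eqF.
    apply: (@stabilizes_zero _ _ _ _ _ e1 x2) => //; first by move=> u /sK /e1K.
    transitivity p.[z]; last exact/rootP.
    rewrite horner_exponent_poly (teval_coef _ _ _ _ uX' X'P).
    by apply: eq_bigr => l _; rewrite x2E tpow_nat // /x2 eqxx.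
  have nP l : l != 0 -> tnull (tcoef l P).
    by move=> l0; apply: contrapT => nl; apply: noc; exists l.
  have [e' [s' [expe' e'e ss' H]]] := IH T.1 (tcoef 0 P) indT1.
  exists e', s'; split=> // e'' ELA e''e'; have [[_ expe''] _ _] := ELA.
  case: (H _ ELA e''e') => [[y y0]|[u uE]]; [left|right].
    by exists y; rewrite (teval_single _ _ _ expe'' nP) y0 mul0r.
  by exists u; rewrite [LHS](teval_single _ _ _ (expR _) nP) tpow0 // mulr1.
have ni' : (n <= i)%N by rewrite leqNgt.
have [[k nk]|noc] := pselect (exists k, ~ tnull (tcoef k P)); last first.
  apply: (@stabilizes_zero _ _ _ _ _ e (fun=> 0)) => //; apply: teval_null => // k.
  by apply: contrapT => nk; apply: noc; exists k.
(* A value of exp is nonzero, so the root has to be nonzero as well; this takes two terms. *)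
have [[l [lk nl]]|noc] := pselect (exists l, l != k /\ ~ tnull (tcoef l P)).
  have yP := exponent_notin nfK X0 expe1 ni' bT indT gT.
  have qK := nf_qsubspace nfK; have qD := tvalues_qsubspace x qK expe1 T.1.
  have [N0 [f [f_inj eP]]] :=
    exponential_prescribe [seq expt_rat k | k <- X'] expe1 qD yP.
  pose g (k : expt (i < n)%N) := f (expt_rat k).
  have g_inj : {in X' &, injective g}.
    move=> a b aX bX /f_inj; rewrite !map_f // => /(_ isT isT).
    exact: (@expt_rat_inj _ ni).
  have [||| z z0 pz] := @root_neq0 _ (exponent_poly X' g c : {poly algC}) (g l) (g k).
  - by rewrite (inj_in_eq g_inj) ?cX'.
  - by rewrite coef_exponent_poly ?cX' ?c0.
  - by rewrite coef_exponent_poly ?cX' ?c0.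
  have [e2 [expe2 e2D e2z]] := eP z z0.
  have e2E : tev e2 x T.1 =1 tev e1 x T.1 by apply: (teval_local qK expe1).
  have KD := @tvalues_const n K e1 x expe1 i T.1.
  apply: (@stabilizes_zero _ _ _ _ _ e2 x) => //.
    by move=> u /sK Ku; rewrite e2D ?e1K //; exact: KD.
  apply: (mulfI (expf_neq0 N0 z0)); rewrite mulr0.
  transitivity (exponent_poly X' g c).[z]; last exact/rootP.
  rewrite horner_exponent_poly (teval_coef _ _ _ _ uX' X'P) mulr_sumr.
  apply: eq_big_seq => j jX.
  by rewrite e2E tpow_rat // e2E /= mulrCA e2z ?map_f.
have nP l : l != k -> tnull (tcoef l P).
  by move=> l0; apply: contrapT => nl; apply: noc; exists l.
have [e' [s' [expe' e'e ss' H]]] := IH T.1 (tcoef k P) indT1.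
exists e', s'; split=> // e'' ELA e''e'; have [[_ expe''] _ _] := ELA.
case: (H _ ELA e''e') => [[y y0]|[u uE]]; [left|right].
  by exists y; rewrite (teval_single _ _ _ expe'' nP) y0 mul0r.
have [_ expD] := expR e''.
by eexists; rewrite [LHS](teval_single _ _ _ (expR _) nP) tpow_rat // [X in X * _]uE -expD.
Qed.

End Solving.

(** * Representing exponential polynomials in towers *)

Section Representation.
Variable n : nat.
Implicit Types (e : algC -> algC) (s : seq algC).
Local Notation tpoly := (tpoly algC n).
Local Notation tower := (tower algC n).

Fixpoint var_tower r : tower r :=
  if r is i.+1 return tower r then (var_tower i, tzero _ _ i) else tt.

Lemma var_tower_indep r : (r <= n)%N -> tindep (var_tower r).
Proof.
elim: r => //= i IH ni; split; first exact/IH/ltnW.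
by rewrite leqNgt ni.
Qed.

Lemma tterm_lift e i (T : tower i.+1) (P : tpoly i) :
  tterm e T (tlift P) = tterm e T.1 P.
Proof. exact/teval_lift/expoly_exponential. Qed.

Lemma tterm_const e r (T : tower r) c : tterm e T (tconst n c r) = expoly_const e n c.
Proof. exact/teval_const/expoly_exponential. Qed.

Lemma var_tower_var r (T : tower r) i : (i < r)%N -> (i < n)%N ->
  exists P, forall e, tterm e T P = expoly_vars n e i.
Proof.
elim: r T => // j IH T; rewrite ltnS leq_eqVlt => /orP[/eqP ij|ij] ni; last first.
  by have [P PE] := IH T.1 ij ni; exists (tlift P) => e; rewrite tterm_lift.
subst j.
have [k kE] : exists k : expt (i < n)%N,
    forall e (y : expoly e n),
      tpow (@expoly_exp _ e n) (expoly_const e n) (expoly_vars n e i) y k =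
      expoly_vars n e i.
  case: (i < n)%N ni => // _.
  by exists (1%N : expt true) => e y; rewrite /= expr1.
exists [:: (tconst n 1 i, k)] => e.
by rewrite [LHS]big_seq1 kE [X in X * _]tterm_const [LHS]mul1r.
Qed.

Definition rat_expt b (q : rat) : expt b :=
  if b is true return expt b then 0%N else q.

Lemma tpow_rat_expt (R : comPzRingType) E (phi : algC -> R) (u v : R) (b : bool) q :
  ~~ b -> tpow E phi u v (rat_expt b q) = E (phi (ratr q) * v).
Proof. by case: b. Qed.

(** The exponential of c + q_n g_n + ... is [e c] times a monomial in the exponential variables of
    the tower. The list [s] fixes the value at c, which becomes a coefficient. *)
Lemma tspan_exp e r (T : tower r) P : tspan setT T P -> exists (Q : tpoly r) s,
  forall e', {in s, e' =1 e} -> expoly_exp (tterm e' T P) = tterm e' T Q.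
Proof.
elim: r T P => [|i IH] T P.
  move=> _; exists (e P), [:: P] => e' /(_ P (mem_head _ _)) e'P.
  by rewrite -[tterm e' T P]/(expoly_const e' n P) -expoly_constE e'P.
move=> [P' [q [sP' q0 ->]]]; have [Q [s QE]] := IH _ _ sP'.
exists [:: (Q, rat_expt (i < n)%N q)], s => e' /QE {}QE.
have expE := expoly_exponential e' n; have [_ expD] := expE.
rewrite [tterm _ _ _](teval_add _ _ _ _ (tlift P') (tlift _)).
rewrite expD [X in expoly_exp X * _]tterm_lift QE.
rewrite [X in _ * expoly_exp X]tterm_lift [RHS]big_seq1 /=; congr (_ * _).
rewrite [tterm _ _ _]teval_scale; case: (boolP (i < n)%N) => ni; last first.
  by rewrite tpow_rat_expt.
by rewrite q0 // !rmorph0 mul0r; case: expE => ->; case: (i < n)%N ni.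
Qed.

(* [iota] transports what was already represented to the longer tower. *)
Lemma represent e (t : eterm algC n) r (T : tower r) :
    (n <= r)%N -> tindep T ->
    (forall i : 'I_n, exists P, forall e', tterm e' T P = expoly_var e' i) ->
  exists r' (T' : tower r') (iota : tpoly r -> tpoly r') (P' : tpoly r') s,
    [/\ (n <= r')%N, tindep T',
        forall e' P, tterm e' T' (iota P) = tterm e' T P &
        forall e', {in s, e' =1 e} ->
          tterm e' T' P' = \pi_(expoly e' n)%qT t].
Proof.
elim: t r T => [c|i|t1 IH1 t2 IH2|t IH|t1 IH1 t2 IH2|t IH] r T nr indT vT.
- exists r, T, id, (tconst n c r), [::]; split=> // e' _.
  by rewrite tterm_const.
- have [P PE] := vT i; exists r, T, id, P, [::]; split=> // e' _.
  by rewrite PE.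
- have [r1 [T1 [iota1 [P1 [s1 [nr1 indT1 i1 P1E]]]]]] := IH1 r T nr indT vT.
  have [|r2 [T2 [iota2 [P2 [s2 [nr2 indT2 i2 P2E]]]]]] := IH2 r1 T1 nr1 indT1.
    by move=> i; have [P PE] := vT i; exists (iota1 P) => e'; rewrite i1.
  exists r2, T2, (iota2 \o iota1), (tadd (iota2 P1) P2), (s1 ++ s2).
  split=> // [e' P|e' ee']; first by rewrite /= i2 i1.
  rewrite [LHS]teval_add -[RHS]pi_expoly_add; congr (_ + _).
    by rewrite [LHS]i2 P1E // => z zs; apply: ee'; rewrite mem_cat zs.
  by rewrite [LHS]P2E // => z zs; apply: ee'; rewrite mem_cat zs orbT.
- have [r1 [T1 [iota1 [P1 [s1 [nr1 indT1 i1 P1E]]]]]] := IH r T nr indT vT.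
  exists r1, T1, iota1, (tscale (-1) P1), s1; split=> // e' /P1E {}P1E.
  rewrite [LHS]teval_scale rmorphN1 mulN1r -[RHS]pi_expoly_opp.
  by congr (- _); exact: P1E.
- have [r1 [T1 [iota1 [P1 [s1 [nr1 indT1 i1 P1E]]]]]] := IH1 r T nr indT vT.
  have [|r2 [T2 [iota2 [P2 [s2 [nr2 indT2 i2 P2E]]]]]] := IH2 r1 T1 nr1 indT1.
    by move=> i; have [P PE] := vT i; exists (iota1 P) => e'; rewrite i1.
  exists r2, T2, (iota2 \o iota1), (tmul (iota2 P1) P2), (s1 ++ s2).
  split=> // [e' P|e' ee']; first by rewrite /= i2 i1.
  rewrite [LHS]teval_mul ?[RHS]pi_expoly_mul; last exact: expoly_exponential.
  rewrite -[RHS]pi_expoly_mul; congr (_ * _).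
    by rewrite [LHS]i2 P1E // => z zs; apply: ee'; rewrite mem_cat zs.
  by rewrite [LHS]P2E // => z zs; apply: ee'; rewrite mem_cat zs orbT.
have [r1 [T1 [iota1 [P1 [s1 [nr1 indT1 i1 P1E]]]]]] := IH r T nr indT vT.
(* Either the argument of exp lies formally in the span, and its exponential is already in the
   tower, or it becomes the exponent of a new level and independence is kept. *)
have [[P [sP nP]]|indP] :=
    pselect (exists P, tspan setT T1 P /\ tnull (tadd P1 (tscale (-1) P))).
  have [Q [s QE]] := tspan_exp e sP.
  exists r1, T1, iota1, Q, (s1 ++ s); split=> // e' ee'.
  rewrite -QE => [|z zs]; last by apply: ee'; rewrite mem_cat zs orbT.
  rewrite -pi_expoly_exp -P1E => [|z zs]; last by apply: ee'; rewrite mem_cat zs.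
  congr expoly_exp; apply/esym/eqP; rewrite -subr_eq0; apply/eqP.
  have <- : tterm e' T1 (tadd P1 (tscale (-1) P)) = 0.
    by apply: teval_null nP; exact: expoly_exponential.
  by rewrite [RHS]teval_add [X in _ = _ + X]teval_scale rmorphN1 mulN1r.
pose T2 : tower r1.+1 := (T1, P1).
exists r1.+1, T2, (@tlift _ _ r1 \o iota1).
exists [:: (tconst n 1 r1, rat_expt (r1 < n)%N 1)], s1.
split=> [|||e' /P1E P1E'].
- exact: leqW.
- by split=> // _ P sP nP; apply: indP; exists P.
- by move=> e' P; rewrite /= tterm_lift i1.
rewrite [LHS]big_seq1 [X in X * _]tterm_const [LHS]mul1r tpow_rat_expt -?leqNgt //.
by rewrite !rmorph1 mul1r -pi_expoly_exp -P1E'.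
Qed.

Lemma eterm_step e s (t : eterm algC n) : exponential e ->
  exists e' s', [/\ exponential e', {in s, e' =1 e}, {subset s <= s'} &
    forall e'', ELA_field e'' -> {in s', e'' =1 e'} ->
      (exists x : 'I_n -> algC, expoly_eval x (\pi_(expoly e'' n)%qT t) = 0) \/
      (exists g : expoly e'' n, \pi_(expoly e'' n)%qT t = expoly_exp g)].
Proof.
move=> expe; have [|r [T [_ [P [s1 [_ indT _ PE]]]]]] :=
    represent e t (leqnn n) (var_tower_indep (leqnn n)).
  move=> i; have [P PE] := var_tower_var (var_tower n) (ltn_ord i) (ltn_ord i).
  exists P => e'; rewrite PE /expoly_vars.
  case: insubP => [j _ ji|]; last by rewrite ltn_ord.
  by congr expoly_var; exact: val_inj.
(* The values on [s1] are kept too, since [P] represents [t] only for exponentials agreeing with [e]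
   there. *)
have [e' [s' [expe' e'e ss' H]]] := solve (s ++ s1) P expe indT.
exists e', s'; split=> //.
- by move=> z zs; apply: e'e; rewrite mem_cat zs.
- by move=> z zs; apply: ss'; rewrite mem_cat zs.
move=> e'' ELA e''e'; have [[_ expe''] _ _] := ELA.
have <- : tterm e'' T P = \pi_(expoly e'' n)%qT t.
  apply: PE => z zs; rewrite e''e' ?e'e //; last apply: ss'; by rewrite mem_cat zs orbT.
case: (H e'' ELA e''e') => [[x Px]|]; [left|by right].
exists (fun i => x i).
have [[hD hM hE hC] hX] := expoly_eval_hom (fun i : 'I_n => x i) expe''.
set h := expoly_eval _ in hD hM hE hC hX *.
transitivity (teval e'' idfun (h \o expoly_vars n e'') T P).
  by apply: teval_morph => //; [exact: (hC 0)|exact: (hC 1)].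
rewrite -[RHS]Px; apply: teval_congr => i _ ni /=.
rewrite /expoly_vars; case: insubP => [j _ ji|]; last by rewrite ni.
by rewrite hX ji.
Qed.

End Representation.

(** * Construction of the exponential *)

Section Enumeration.
Variable F : countType.

Fixpoint eterm_tree n (t : eterm F n) : GenTree.tree F :=
  match t with
  | EConst a => GenTree.Leaf a
  | EVar i => GenTree.Node 0 [:: GenTree.Node (val i) [::]]
  | EAdd t u => GenTree.Node 1 [:: eterm_tree t; eterm_tree u]
  | EOpp t => GenTree.Node 2 [:: eterm_tree t]
  | EMul t u => GenTree.Node 3 [:: eterm_tree t; eterm_tree u]
  | EExp t => GenTree.Node 4 [:: eterm_tree t]
  end.

Lemma eterm_tree_inj n : injective (@eterm_tree n).
Proof.
elim=> [a|i|t IHt u IHu|t IHt|t IHt u IHu|t IHt] [b|j|t' u'|t'|t' u'|t'] //=.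
- by case=> ->.
- by case=> /val_inj->.
- by case=> /IHt-> /IHu->.
- by case=> /IHt->.
- by case=> /IHt-> /IHu->.
- by case=> /IHt->.
Qed.

(** Coding [n] along with the tree enumerates the terms in all numbers of variables at once. *)
Definition eterm_code n (t : eterm F n) : nat := pickle (n, eterm_tree t).

Lemma eterm_code_inj n m (t : eterm F n) (u : eterm F m) :
  eterm_code t = eterm_code u -> existT _ n t = existT _ m u.
Proof.
move=> /(pcan_inj pickleK)[nm]; case: m / nm u => u /eterm_tree_inj -> //.
Qed.

End Enumeration.

Section Limit.
Implicit Types (e : algC -> algC) (s : seq algC).

(** This step serves surjectivity and freezes the value at [y]. The preimage is taken outside a
    number field containing [s], where the exponential can be prescribed. *)
Lemma value_step e s y : exponential e -> exists e' s',
  [/\ exponential e', {in s, e' =1 e}, {subset s <= s'}, y \in s' &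
      y != 0 -> exists2 a, a \in s' & e' a = y].
Proof.
move=> expe; have [K nfK sK] := number_field_seq s.
(* The bound 2 is the size of X - [a], which would have coefficients in [K] if [a] were in [K]. *)
have [a _ aP] := number_field_generic 2 nfK.
have Ka : ~ K a.
  move=> Ka; have /eqP : 'X - a%:P = 0 :> {poly algC}.
    apply: aP; rewrite ?size_XsubC ?root_XsubC // => i.
    rewrite coefB coefX coefC; apply: nfD => //.
      by case: eqP => _; [exact: nf1 nfK|exact: nf0 nfK].
    by apply: nfN => //; case: eqP => _ //; exact: nf0 nfK.
  by rewrite polyXsubC_eq0.
have [->|y0] := eqVneq y 0.
  exists e, (0 :: s); split=> // [z zs|]; last exact: mem_head.
  by rewrite in_cons zs orbT.
have [e' [expe' e'K e'a]] := exponential_extension expe (nf_qsubspace nfK) Ka y0.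
exists e', [:: a, y & s]; split=> //.
- by move=> z /sK /e'K.
- by move=> z zs; rewrite !in_cons zs !orbT.
- by rewrite !in_cons eqxx orbT.
- by move=> _; exists a => //; exact: mem_head.
Qed.

(** The number [k] is read both as the code of an algebraic number and as the code of a term. *)
Definition meets_requirements k e s :=
  [/\ forall y : algC, pickle y = k ->
        y \in s /\ (y != 0 -> exists2 a, a \in s & e a = y) &
      forall n (t : eterm algC n), eterm_code t = k ->
      forall e'', ELA_field e'' -> {in s, e'' =1 e} ->
        (exists x : 'I_n -> algC, expoly_eval x (\pi_(expoly e'' n)%qT t) = 0) \/
        (exists g : expoly e'' n, \pi_(expoly e'' n)%qT t = expoly_exp g)].

Lemma requirement_step k e s : exponential e -> exists e' s',
  [/\ exponential e', {in s, e' =1 e}, {subset s <= s'} & meets_requirements k e' s'].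
Proof.
move=> expe.
have [e1 [s1 [expe1 e1e ss1 yP]]] : exists e1 s1,
  [/\ exponential e1, {in s, e1 =1 e}, {subset s <= s1} &
   forall y : algC, pickle y = k -> y \in s1 /\ (y != 0 -> exists2 a, a \in s1 & e1 a = y)].
  have [[y yk]|noy] := pselect (exists y : algC, pickle y = k); last first.
    by exists e, s; split=> // y yk; case: noy; exists y.
  have [e1 [s1 [expe1 e1e ss1 ys1 yP]]] := value_step s y expe.
  by exists e1, s1; split=> // z; rewrite -yk => /(pcan_inj pickleK)->.
have [[n [t tk]]|not] :=
    pselect (exists n (t : eterm algC n), eterm_code t = k); last first.
  by exists e1, s1; split=> //; split=> // n t tk; case: not; exists n, t.
have [e2 [s2 [expe2 e2e ss2 tP]]] := eterm_step s1 t expe1.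
exists e2, s2; split=> // [z zs|z /ss1 /ss2//|]; first by rewrite e2e ?e1e ?ss1.
split=> [y /yP[ys1 yE]|m u].
  split=> [|/yE[a as1 ay]]; first exact: ss2.
  by exists a; rewrite ?e2e ?ss2.
rewrite -tk => /eterm_code_inj ut.
(* The number of variables is part of the equality [ut], so the conclusion is transported as a
   predicate on dependent pairs. *)
pose Q (p : {m & eterm algC m}) := forall e'', ELA_field e'' -> {in s2, e'' =1 e2} ->
  (exists x : 'I_(tag p) -> algC,
     expoly_eval x (\pi_(expoly e'' (tag p))%qT (tagged p)) = 0) \/
  (exists g : expoly e'' (tag p),
     \pi_(expoly e'' (tag p))%qT (tagged p) = expoly_exp g).
by have : Q (existT _ n t) := tP; rewrite -ut.
Qed.

Definition state := {p : (algC -> algC) * seq algC | exponential p.1}.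

Lemma limit_exponential : exists e : algC -> algC,
  ELA_field e /\ schanuel_nullstellensatz e.
Proof.
have /choice [next nextP] : forall p : nat * state, exists q : state,
    [/\ {in (sval p.2).2, (sval q).1 =1 (sval p.2).1},
        {subset (sval p.2).2 <= (sval q).2} &
        meets_requirements p.1 (sval q).1 (sval q).2].
  move=> [k [[e s] /= expe]].
  have [e' [s' [expe' e'e ss' H]]] := requirement_step k s expe.
  by exists (exist _ (e', s') expe').
have exp1 : exponential ((fun=> 1) : algC -> algC) by split=> // x y; rewrite mulr1.
pose st := fix st k : state :=
  if k is j.+1 then next (j, st j) else exist _ ((fun=> 1), [::]) exp1.
pose ee k := (sval (st k)).1; pose ss k := (sval (st k)).2.
have expee k : exponential (ee k) by exact: (svalP (st k)).
have ssD j d : {subset ss j <= ss (j + d)%N} /\ {in ss j, ee (j + d)%N =1 ee j}.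
  elim: d => [|d [IH1 IH2]]; first by rewrite addn0; split.
  rewrite addnS; have [eE sE _] := nextP ((j + d)%N, st (j + d)%N).
  by split=> z zs; [exact/sE/IH1|rewrite -IH2 // -[LHS]/((sval _).1 z) eE //; exact: IH1].
have sss j k : (j <= k)%N -> {subset ss j <= ss k}.
  by move=> /subnKC <-; case: (ssD j (k - j)%N).
have eee j k : (j <= k)%N -> {in ss j, ee k =1 ee j}.
  by move=> /subnKC <-; case: (ssD j (k - j)%N).
have reqP k : meets_requirements k (ee k.+1) (ss k.+1).
  by case: (nextP (k, st k)).
pose ix (y : algC) := (pickle y).+1.
have ssP y : y \in ss (ix y) by have [/(_ y erefl)[]] := reqP (pickle y).
(* From stage [ix y] on, [y] belongs to the set of fixed arguments, so this value is final. *)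
pose e y := ee (ix y) y.
have eE k : {in ss k, e =1 ee k}.
  move=> z zk; rewrite /e; case: (leqP k (ix z)) => [|/ltnW] kz; first exact: eee.
  by rewrite (eee _ _ kz).
have eE' k z : (ix z <= k)%N -> e z = ee k z by move=> kz; apply/eE/(sss _ _ kz)/ssP.
have expe : exponential e.
  split; first by rewrite (eE' _ 0 (leqnn _)); case: (expee (ix 0)).
  move=> y z; pose k := (ix y + ix z + ix (y + z)%R)%N.
  by rewrite !(eE' k) /k; [case: (expee k)|lia..].
have ELA : ELA_field e.
  split; [split=> //; exact: pchar_num|exact: solve_monicpoly|].
  move=> y y0; have [/(_ y erefl)[_ /(_ y0)[a sa aE]] _] := reqP (pickle y).
  by exists a; rewrite (eE (ix y)).
exists e; split=> // n f; have [t ->] : exists t, f = \pi_(expoly e n)%qT t.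
  by exists (repr f); rewrite reprK.
move=> fg; have [_ /(_ n t erefl e ELA (eE _))] := reqP (eterm_code t).
by case=> // -[g gE]; case: (fg g).
Qed.

End Limit.

(** * Ideals containing the coherence polynomials *)

Section KummerRing.
Variables (F : fieldType) (n : nat).
Local Notation KR := (kummer_ring F n).
Local Notation Mon := (cmonom (Rvar n)).

Definition RV (i : Rvar n) : KR := mkmalgU (ucm i) 1.

Lemma kummer_mulUU (c d : F) (k l : Mon) :
  mkmalgU k c * mkmalgU l d = mkmalgU (mmul k l) (c * d) :> KR.
Proof. by rewrite [LHS]malgM_def fgmulUU. Qed.

Lemma kummer_ind (P : KR -> Prop) :
    (forall c, P (RC n c)) -> (forall i, P (RV i)) ->
    (forall f g, P f -> P g -> P (f + g)) -> (forall f g, P f -> P g -> P (f * g)) ->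
  forall f, P f.
Proof.
move=> PC PV PD PM f; rewrite (monalgE f); elim/big_ind: _ => // [|m _].
  by have := PC 0; rewrite raddf0.
have -> : mkmalgU m (monalg.mcoeff m f) = RC n (monalg.mcoeff m f) * mkmalgU m 1 :> KR.
  by rewrite /RC kummer_mulUU mulr1 mul1m.
apply: (PM) => //; have [d] := ubnP (monalg.mdeg m); elim: d m => // d IH m md.
have [/monalg.mdeg_eq0I ->|m0] := eqVneq (monalg.mdeg m) 0%N; first exact: (PC 1).
have [i mi] : exists i, (0 < m i)%N.
  apply: contrapT => no; case/eqP: m0; rewrite monalg.mdegE big1 // => i _.
  by apply/eqP; rewrite -leqn0 leqNgt; apply/negP => mi; apply: no; exists i.
have mE : m = mmul (ucm i) (divcm m (ucm i)).
  apply/eqP/cmP => j; rewrite cmM [divcm _ _ _]divcmE ucmE subnKC //.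
  by case: eqP mi => [->|].
have -> : mkmalgU m 1 = RV i * mkmalgU (divcm m (ucm i)) 1 :> KR.
  by rewrite /RV kummer_mulUU mulr1 -mE.
apply: (PM) => //; apply: IH; move: md; rewrite mE monalg.mdegM monalg.mdegU add1n ltnS.
by rewrite -mE.
Qed.

Section Evaluation.
Variables (v : Rvar n -> F).

Definition cmeval (m : Mon) : F := \prod_(i <- finsupp m) v i ^+ m i.

Lemma cmeval_widen (d : {fset Rvar n}) (m : Mon) : (finsupp m `<=` d)%fset ->
  cmeval m = \prod_(i <- d) v i ^+ m i.
Proof.
move=> le; rewrite /cmeval (big_fset_incl _ le) // => i _.
by rewrite -cmE_neq0 negbK => /eqP ->; rewrite expr0.
Qed.

Lemma cmevalM : monalg.mmorphism cmeval.
Proof.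
split=> [m1 m2|]; last by rewrite /cmeval mdom1 big_seq_fset0.
rewrite (@cmeval_widen (finsupp m1 `|` finsupp m2)%fset) ?mdomD //.
rewrite (@cmeval_widen (finsupp m1 `|` finsupp m2)%fset m1) ?fsubsetUl //.
rewrite (@cmeval_widen (finsupp m1 `|` finsupp m2)%fset m2) ?fsubsetUr //.
by rewrite -big_split /=; apply: eq_bigr => i _; rewrite cmM exprD.
Qed.

HB.instance Definition _ := monalg.isMultiplicative.Build Mon F cmeval cmevalM.

Definition kummer_eval : KR -> F := monalg.mmap idfun cmeval.
HB.instance Definition _ := GRing.RMorphism.copy kummer_eval kummer_eval.

Lemma kummer_evalD : {morph kummer_eval : f g / f + g}. Proof. exact: rmorphD. Qed.
Lemma kummer_evalB : {morph kummer_eval : f g / f - g}. Proof. exact: rmorphB. Qed.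
Lemma kummer_evalM : {morph kummer_eval : f g / f * g}. Proof. exact: rmorphM. Qed.
Lemma kummer_evalX k : {morph kummer_eval : f / f ^+ k}. Proof. exact: rmorphXn. Qed.
Lemma kummer_eval0 : kummer_eval 0 = 0. Proof. exact: rmorph0. Qed.
Lemma kummer_eval1 : kummer_eval 1 = 1. Proof. exact: rmorph1. Qed.

Lemma kummer_evalC c : kummer_eval (RC n c) = c.
Proof. by rewrite /kummer_eval monalg.mmapC. Qed.

Lemma kummer_evalV i : kummer_eval (RV i) = v i.
Proof.
by rewrite /kummer_eval monalg.mmapU mul1r /= /cmeval mdomU big_seq_fset1 cmUU expr1.
Qed.

End Evaluation.
End KummerRing.

Section CoherentIdeals.
Variable F : numClosedFieldType.
Local Notation KR := (kummer_ring F 1).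
Local Notation X := (RX F ord0).
Local Notation Y m := (RY F m ord0).
Implicit Types (J : set KR) (f g : KR) (p q : {poly F}).

(** The index is N + 1, nonzero by computation; hence the shifts [.+1] and [.-1] below. *)
Definition nzpos (N : nat) : nzint := exist _ N.+1%:Z isT.
Definition nzneg (N : nat) : nzint := exist _ (- N.+1%:Z) isT.

Record coherent_ideal J : Prop := {
  coh0 : J 0;
  cohD : forall f g, J f -> J g -> J (f + g);
  cohM : forall f g, J g -> J (f * g);
  coh_root : @coherence_root F 1 `<=` J;
  coh_inv : @coherence_inv F 1 `<=` J;
  cohXY : J (X - Y nzint1) }.

Definition eqmodJ J f g := J (f - g).

Section Congruence.
Variables (J : set KR) (cJ : coherent_ideal J).
Local Notation "f ~~ g" := (eqmodJ J f g) (at level 70).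

Lemma eqmodJ_refl f : f ~~ f.
Proof. by rewrite /eqmodJ subrr; exact: coh0. Qed.

Lemma eqmodJ_sym f g : f ~~ g -> g ~~ f.
Proof. by move=> /(cohM cJ (-1)); rewrite mulN1r opprB. Qed.

Lemma eqmodJ_trans f g h : f ~~ g -> g ~~ h -> f ~~ h.
Proof. by move=> fg gh; have := cohD cJ fg gh; rewrite addrA subrK. Qed.

Lemma eqmodJ_add f f' g g' : f ~~ f' -> g ~~ g' -> f + g ~~ f' + g'.
Proof. by move=> ff gg; have := cohD cJ ff gg; congr J; ring. Qed.

Lemma eqmodJ_mul f f' g g' : f ~~ f' -> g ~~ g' -> f * g ~~ f' * g'.
Proof.
move=> ff gg; have := cohD cJ (cohM cJ g ff) (cohM cJ f' gg).
by congr J; ring.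
Qed.

Lemma eqmodJ_exp f f' k : f ~~ f' -> f ^+ k ~~ f' ^+ k.
Proof.
move=> ff; elim: k => [|k IH]; first exact: eqmodJ_refl.
by rewrite !exprS; exact: eqmodJ_mul.
Qed.

Lemma eqmodJ_mem f g : f ~~ g -> J g -> J f.
Proof. by move=> fg /(cohD cJ fg); rewrite subrK. Qed.

Lemma eqmodJ_root (m m' : nzint) r : (0 < r)%N -> val m' = val m * r%:Z ->
  Y m ~~ Y m' ^+ r.
Proof. by move=> r0 m'E; apply/eqmodJ_sym/(coh_root cJ); exists m, m', r, ord0. Qed.

Lemma eqmodJ_inv N : Y (nzpos N) * Y (nzneg N) ~~ 1.
Proof. by apply: (coh_inv cJ); exists (nzpos N), (nzneg N), ord0. Qed.

End Congruence.

Definition psubst p N : KR := (map_poly (RC 1) p).[Y (nzpos N)].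

Lemma psubstM p q N : psubst (p * q) N = psubst p N * psubst q N.
Proof. by rewrite /psubst rmorphM hornerM. Qed.

Lemma psubstD p q N : psubst (p + q) N = psubst p N + psubst q N.
Proof. by rewrite /psubst rmorphD hornerD. Qed.

Lemma psubst0 N : psubst 0 N = 0.
Proof. by rewrite /psubst rmorph0 horner0. Qed.

Lemma psubstXn k N : psubst 'X^k N = Y (nzpos N) ^+ k.
Proof. by rewrite /psubst map_polyXn hornerXn. Qed.

Lemma psubstC c N : psubst c%:P N = RC 1 c.
Proof. by rewrite /psubst map_polyC hornerC. Qed.

(** As [k] and [p] do not depend on [J], the same Laurent polynomial can be used to compare
    different ideals. *)
Definition represented f N := exists k p, forall J, coherent_ideal J ->
  eqmodJ J (f * Y (nzpos N) ^+ k) (psubst p N).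

Lemma shift_sum (R : comPzRingType) (f g y : R) k l :
  (f + g) * y ^+ (k + l) = f * y ^+ k * y ^+ l + g * y ^+ l * y ^+ k.
Proof. by rewrite exprD; ring. Qed.

Lemma shift_prod (R : comPzRingType) (f g y : R) k l :
  f * g * y ^+ (k + l) = f * y ^+ k * (g * y ^+ l).
Proof. by rewrite exprD; ring. Qed.

Lemma common_multiple a b d :
  (a.+1 * (b.+1 * d.+1).-1.+1).-1 = ((a.+1 * b.+1).-1.+1 * d.+1).-1.
Proof. by rewrite !prednK ?muln_gt0 // mulnA. Qed.

(* Modulo the coherence polynomials and X - Y_1, every element is a Laurent
   polynomial in a single Y_N, where N can be replaced by any multiple. *)
Lemma represented_multiple f : exists N, forall d, represented f (N.+1 * d.+1).-1.
Proof.
elim/kummer_ind: f => [c|[i|[[m m0] i]]|f g [N1 H1] [N2 H2]|f g [N1 H1] [N2 H2]].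
- exists 0%N => d; exists 0%N, c%:P => J cJ; rewrite mulr1 psubstC; exact: eqmodJ_refl.
- exists 0%N => d; exists 0%N, 'X^(d.+1) => J cJ; rewrite mulr1 psubstXn mul1n /=.
  rewrite (ord1 i); apply: (eqmodJ_trans cJ (cohXY cJ)).
  by apply: (eqmodJ_root cJ) => //=; rewrite mul1r.
- exists `|m|.-1 => d; rewrite (ord1 i) prednK ?absz_gt0 //; set N := (_ * _).-1.
  have NE : N.+1 = (`|m| * d.+1)%N by rewrite prednK // muln_gt0 absz_gt0 m0.
  have [mpos|mneg] : 0 < m \/ m < 0 by lia.
    exists 0%N, 'X^(d.+1) => J cJ; rewrite mulr1 psubstXn.
    by apply: (eqmodJ_root cJ) => //=; rewrite NE; lia.
  (* For negative [m] this power of Y_N is congruent to Y_(-m), the inverse of Y_m. *)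
  exists d.+1, 1 => J cJ; rewrite -polyC1 psubstC rmorph1.
  have mN : (- m) != 0 by lia.
  apply: (@eqmodJ_trans _ cJ _ (Y (exist _ m m0) * Y (exist _ (- m) mN))); last first.
    by apply: (coh_inv cJ); exists (exist _ m m0), (exist _ (- m) mN), ord0.
  apply: (eqmodJ_mul cJ (eqmodJ_refl cJ _)); apply: (eqmodJ_sym cJ).
  by apply: (eqmodJ_root cJ) => //=; rewrite NE; lia.
- exists (N1.+1 * N2.+1).-1 => d.
  have [k [p pE]] := H1 (N2.+1 * d.+1).-1; have [l [q qE]] := H2 (N1.+1 * d.+1).-1.
  rewrite common_multiple in pE; rewrite common_multiple (mulnC N2.+1) in qE.
  exists (k + l)%N, (p * 'X^l + q * 'X^k) => J cJ.
  move/(_ J cJ): pE => pE; move/(_ J cJ): qE => qE.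
  rewrite shift_sum (psubstD (p * _)) (psubstM p) (psubstM q) !psubstXn.
  exact: (eqmodJ_add cJ (eqmodJ_mul cJ pE (eqmodJ_refl cJ _))
                        (eqmodJ_mul cJ qE (eqmodJ_refl cJ _))).
- exists (N1.+1 * N2.+1).-1 => d.
  have [k [p pE]] := H1 (N2.+1 * d.+1).-1; have [l [q qE]] := H2 (N1.+1 * d.+1).-1.
  rewrite common_multiple in pE; rewrite common_multiple (mulnC N2.+1) in qE.
  exists (k + l)%N, (p * q) => J cJ.
  move/(_ J cJ): pE => pE; move/(_ J cJ): qE => qE.
  by rewrite shift_prod (psubstM p); exact: (eqmodJ_mul cJ pE qE).
Qed.

Definition root_system (t : rat -> F) :=
  t 0 = 1 /\ {morph t : x y / x + y >-> x * y}.

Definition root_point (t : rat -> F) (i : Rvar 1) : F :=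
  match i with inl _ => t 1 | inr (m, _) => t (val m)%:~R^-1 end.

(* The points of the pro-cover of the curve Y = X are the coherent systems of
   roots of nonzero elements of F, that is the homomorphisms from Q to F^*. *)
Definition pro_cover_ideal : set KR :=
  [set f | forall t, root_system t -> kummer_eval (root_point t) f = 0].

Lemma root_systemMn t (q : rat) k : root_system t -> t (q *+ k) = t q ^+ k.
Proof.
move=> [t0 tD]; elim: k => [|k IH]; first by rewrite mulr0n t0 expr0.
by rewrite mulrS tD IH exprS.
Qed.

Lemma root_system_neq0 t (q : rat) : root_system t -> t q != 0.
Proof.
move=> [t0 tD]; apply/eqP => tq; have /eqP := tD q (- q).
by rewrite subrr t0 tq mul0r oner_eq0.
Qed.

Lemma root_system_coherent t : root_system t ->
  coherent_ideal [set f | kummer_eval (root_point t) f = 0].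
Proof.
move=> rt; have [t0 tD] := rt.
have eX : kummer_eval (root_point t) X = t 1 by exact: kummer_evalV.
have eY m : kummer_eval (root_point t) (Y m) = t (val m)%:~R^-1 by exact: kummer_evalV.
split.
- exact: kummer_eval0.
- by move=> f g f0 g0; rewrite /mkset kummer_evalD f0 g0 addr0.
- by move=> f g g0; rewrite /mkset kummer_evalM g0 mulr0.
- move=> _ [m [m' [r [i [r0 m'E ->]]]]]; rewrite (ord1 i) /mkset.
  rewrite kummer_evalB kummer_evalX.
  transitivity (t (val m')%:~R^-1 ^+ r - t (val m)%:~R^-1).
    by congr (_ ^+ _ - _); exact: eY.
  rewrite -root_systemMn //; apply/eqP; rewrite subr_eq0; apply/eqP; congr t.
  rewrite m'E intrM -[_ *+ r]mulr_natr invfM -mulrA -pmulrn mulVf ?mulr1 //.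
  by rewrite pnatr_eq0 -lt0n.
- move=> _ [m [m' [i [m'E ->]]]]; rewrite (ord1 i) /mkset.
  rewrite kummer_evalB kummer_evalM.
  transitivity (t (val m)%:~R^-1 * t (val m')%:~R^-1 - 1).
    by congr (_ * _ - _); [exact: eY|exact: eY|exact: kummer_eval1].
  by rewrite -tD m'E rmorphN invrN subrr t0 subrr.
- rewrite /mkset kummer_evalB; transitivity (t 1 - t 1); last exact: subrr.
  by congr (_ - _); [exact: eX|apply: etrans (eY nzint1) _; congr t; exact: invr1].
Qed.

(** Precompose the homomorphism of [rat_hom] with multiplication by N + 1. *)
Lemma root_system_exists (s : F) N : s != 0 ->
  exists2 t, root_system t & t N.+1%:R^-1 = s.
Proof.
move=> s0; have [t [t1 tD]] := rat_hom s0.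
have N0 : N.+1%:R != 0 :> rat by rewrite pnatr_eq0.
exists (fun r : rat => t (r * N.+1%:R)); last by rewrite mulVf.
split=> [|x y]; last by rewrite mulrDl tD.
rewrite mul0r; have t10 : t 1 != 0 by rewrite t1.
by apply: (mulfI t10); rewrite -tD addr0 mulr1.
Qed.

End CoherentIdeals.

(** * The curve Y = X is perfectly rotund *)

Section Diagonal.
Variable F : numClosedFieldType.
Implicit Types (a : F) (f : laurent F 1) (p q : {poly F}).

Definition diag a : Gspace F 1 := (const_mx a, const_mx a).

Definition diag_curve : set (Gspace F 1) := [set diag a | a in [set a | a != 0]].

Lemma diag_curveE : diag_curve = zero_locus [set LX F ord0 - LY F ord0].
Proof.
rewrite predeqE => -[x y]; split=> [[a a0 [<- <-]]|[Gxy /(_ _ erefl)]].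
  split=> [i|_ ->]; first by rewrite mxE.
  by rewrite /leval mevalB -!/(leval _ _) leval_LX leval_LY !mxE subrr.
rewrite /leval mevalB -!/(leval _ _) leval_LX leval_LY /= => /eqP.
rewrite subr_eq0 => /eqP xy; exists (y ord0 0); first exact: (Gxy ord0).
by congr (_, _); apply/colP => i; rewrite mxE (ord1 i).
Qed.

Lemma poly_eq0_nonzero p : (forall a, a != 0 -> p.[a] = 0) -> p = 0.
Proof.
move=> p0; apply/eqP; apply: contraT => pn0.
have /closed_nonrootP[a] : p * 'X != 0 by rewrite mulf_neq0 ?polyX_eq0.
by rewrite rootE hornerMX mulf_eq0 negb_or => /andP[/eqP pa /p0].
Qed.

(** At [diag a] both coordinates are [a] and the inverse variable is 1 / [a], so a power of [a]
    clears the denominators. *)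
Lemma leval_laurent f : exists k p,
  forall a, a != 0 -> leval f (diag a) * a ^+ k = p.[a].
Proof.
have key (i : 'I_(1 + 1 + 1)) : exists k p, forall a, a != 0 ->
    leval ('X_i : {mpoly F[1 + 1 + 1]}) (diag a) * a ^+ k = p.[a].
  case: (splitP i) => [j ij|j ij]; last first.
    have -> : i = rshift (1 + 1) j by apply/val_inj.
    exists 1%N, 1 => a a0; rewrite -[X in leval X _]/(LYinv F j) leval_LYinv mxE hornerC.
    exact: mulVf.
  have -> : i = lshift 1 j by apply/val_inj.
  exists 0%N, 'X => a a0; rewrite mulr1 hornerX.
  case: (splitP j) => l jl.
    by have -> : j = lshift 1 l by [apply/val_inj]; rewrite -/(LX F l) leval_LX mxE.
  by have -> : j = rshift 1 l by [apply/val_inj]; rewrite -/(LY F l) leval_LY mxE.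
elim/mpolyind: f => [|c m f _ _ [l [q fE]]].
  by exists 0%N, 0 => a _; rewrite /leval meval0 mul0r horner0.
have [k [p mE]] : exists k p, forall a, a != 0 ->
    leval ('X_[m] : {mpoly F[1 + 1 + 1]}) (diag a) * a ^+ k = p.[a].
  pose Q (g : F -> F) := exists k p, forall a, a != 0 -> g a * a ^+ k = p.[a].
  suff [k [p pE]] : Q (fun a => \prod_(i < 1 + 1 + 1)
      leval ('X_i : {mpoly F[1 + 1 + 1]}) (diag a) ^+ m i).
    exists k, p => a a0; rewrite -pE // /leval mevalX; congr (_ * _).
    by apply: eq_bigr => i _; rewrite mevalXU.
  have QM g h : Q g -> Q h -> Q (fun a => g a * h a).
    move=> [k [p gE]] [j [r hE]]; exists (k + j)%N, (p * r) => a a0.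
    by rewrite exprD mulrACA gE // hE // hornerM.
  have Q1 : Q (fun=> 1) by exists 0%N, 1 => a _; rewrite mulr1 hornerC.
  have QX g d : Q g -> Q (fun a => g a ^+ d).
    move=> Qg; elim: d => [|d IH]; first exact: Q1.
    by under eq_fun do rewrite exprS; exact: QM.
  elim: (index_enum _) => [|i r IH]; first by under eq_fun do rewrite big_nil.
  by under eq_fun do rewrite big_cons; apply: QM => //; exact/QX/key.
exists (k + l)%N, (c *: p * 'X^l + q * 'X^k) => a a0.
rewrite /leval mevalD mevalZ -!/(leval _ _) hornerD !hornerM hornerZ !hornerXn.
rewrite -mE // -fE //.
by rewrite exprD; ring.
Qed.

(** Regular functions on the curve are Laurent polynomials in [a], and a product of two nonzero ones
    is nonzero. *)
Lemma diag_curve_irreducible : irreducible_subvariety diag_curve.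
Proof.
split; first by rewrite diag_curveE; eexists.
  by exists (diag 1), 1 => //=; exact: oner_neq0.
move=> _ _ [P1 ->] [P2 ->] V12; apply: contrapT => /not_orP[V1 V2].
have out P : ~ diag_curve `<=` zero_locus P ->
    exists f, P f /\ exists2 a, a != 0 & leval f (diag a) != 0.
  move=> nV; apply: contrapT => nf; apply: nV => _ [a a0 <-]; split=> [i|f Pf].
    by rewrite mxE.
  by apply/eqP; apply: contrapT => /negP fa; apply: nf; exists f; split=> //; exists a.
have [f [Pf [a a0 fa]]] := out _ V1; have [g [Pg [b b0 gb]]] := out _ V2.
have [k [p pE]] := leval_laurent f; have [l [q qE]] := leval_laurent g.
have p0 : p != 0.
  apply: contraNneq fa => p0; have := pE a a0; rewrite p0 horner0 => /eqP.
  by rewrite mulf_eq0 expf_eq0 (negbTE a0) andbF orbF.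
have q0 : q != 0.
  apply: contraNneq gb => q0; have := qE b b0; rewrite q0 horner0 => /eqP.
  by rewrite mulf_eq0 expf_eq0 (negbTE b0) andbF orbF.
have /eqP : p * q = 0.
  apply: poly_eq0_nonzero => c c0; rewrite hornerM -pE // -qE //.
  have [[_ /(_ f Pf)->]|[_ /(_ g Pg)->]] := V12 (diag c) (ex_intro2 _ _ c c0 erefl).
    by rewrite !mul0r.
  by rewrite !mul0r mulr0.
by rewrite mulf_eq0 (negbTE p0) (negbTE q0).
Qed.

Lemma diag_curve_dim_ge1 : dim_ge diag_curve 1.
Proof.
exists (fun=> LX F ord0) => q q0.
have m_inj : {in msupp q &, injective (fun m : 'X_{1..1} => m ord0)}.
  by move=> m m' _ _ mm; apply/mnmP => i; rewrite (ord1 i).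
have pE : exponent_poly (msupp q) (fun m : 'X_{1..1} => m ord0) (fun m => q@_m) = 0.
  apply: poly_eq0_nonzero => a a0; rewrite horner_exponent_poly.
  rewrite -[RHS](q0 (diag a)); last by exists a.
  rewrite mevalE; apply: eq_bigr => m _.
  by rewrite big_ord1 leval_LX mxE.
apply/mpolyP => m; rewrite mcoeff0; have [mq|] := boolP (m \in msupp q).
  have := coef_exponent_poly (fun m => q@_m) (msupp_uniq q) m_inj mq.
  by rewrite pE coef0.
by move=> /memN_msupp_eq0.
Qed.

End Diagonal.

Section DiagonalDimension.
Variable F : numClosedFieldType.
Implicit Types (a : F).

(* Two Laurent polynomials of degree at most N are algebraically dependent:
   the L ^ 2 monomials of bidegree less than L in them span a space of
   dimension at most 4 * N * L + 1. *)
Lemma diag_curve_dim_lt2 : ~ dim_ge (@diag_curve F) 2.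
Proof.
move=> [g g_ind].
have /choice [kp kpE] : forall i, exists kp : nat * {poly F},
    forall a, a != 0 -> leval (g i) (diag a) * a ^+ kp.1 = kp.2.[a].
  by move=> i; have [k [p E]] := leval_laurent (g i); exists (k, p).
pose K := ((kp ord0).1 + (kp ord_max).1)%N.
pose P i := (kp i).2 * 'X^(K - (kp i).1).
have kK i : ((kp i).1 <= K)%N.
  rewrite /K; case: i => [[|[|//]] lt2].
    by rewrite (_ : Ordinal lt2 = ord0) ?leq_addr //; apply/val_inj.
  by rewrite (_ : Ordinal lt2 = ord_max) ?leq_addl //; apply/val_inj.
have PE i a : a != 0 -> (P i).[a] = leval (g i) (diag a) * a ^+ K.
  by move=> a0; rewrite hornerM hornerXn -kpE // -mulrA -exprD subnKC.
pose N := (size (P ord0) + size (P ord_max) + K)%N.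
(* This [L] makes L^2 = 4 N L + 2 L exceed [M]. *)
pose L := (4 * N + 2)%N; pose M := (4 * N * L + 1)%N.
pose J := ('I_L * 'I_L)%type.
(* The power of X gives all the products the same denominator a^(2 K L), so a linear relation
   between the [R ij] is one between monomials in [g]. *)
pose R (ij : J) := P ord0 ^+ ij.1 * P ord_max ^+ ij.2 * 'X^(K * (2 * L - (ij.1 + ij.2))).
have sR ij : (size (R ij) <= M)%N.
  have s0 := size_poly_exp_leq (P ord0) ij.1.
  have s1 := size_poly_exp_leq (P ord_max) ij.2.
  rewrite (leq_trans (size_polyMleq _ _)) // size_polyXn.
  have s2 := size_polyMleq (P ord0 ^+ ij.1) (P ord_max ^+ ij.2).
  have [i0 j0] : (ij.1 < L)%N /\ (ij.2 < L)%N by split; exact: ltn_ord.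
  have h0 : ((size (P ord0)).-1 * ij.1 <= N * L)%N.
    by apply: leq_mul; [rewrite /N; lia|exact: ltnW].
  have h1 : ((size (P ord_max)).-1 * ij.2 <= N * L)%N.
    by apply: leq_mul; [rewrite /N; lia|exact: ltnW].
  have h2 : (K * (2 * L - (ij.1 + ij.2)) <= N * (2 * L))%N.
    by apply: leq_mul; [rewrite /N; lia|exact: leq_subr].
  by rewrite /M; lia.
pose A : 'M[F]_(#|{: J}|, M) := \matrix_(r, c) (R (enum_val r))`_c.
have /rowV0Pn [c /sub_kermxP cA c0] : kermx A != 0.
  rewrite -mxrank_eq0 mxrank_ker -lt0n subn_gt0 (leq_ltn_trans (rank_leq_col A)) //.
  by rewrite card_prod !card_ord /M /L; nia.
have R0 : \sum_r c 0 r *: R (enum_val r) = 0.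
  apply/polyP => k; rewrite coef0 coef_sum; case: (ltnP k M) => kM.
    have /rowP /(_ (Ordinal kM)) := cA; rewrite !mxE => cAk; rewrite -[RHS]cAk.
    by apply: eq_bigr => r _; rewrite coefZ mxE.
  by rewrite big1 // => r _; rewrite coefZ nth_default ?mulr0 // (leq_trans (sR _)).
pose mon (ij : J) : 'X_{1..2} :=
  [multinom (if t == ord0 then ij.1 : nat else ij.2) | t < 2].
have mon_inj : injective mon.
  move=> [i j] [i' j'] /mnmP ij; congr (_, _); apply/val_inj.
    by have := ij ord0; rewrite !mnmE.
  by have := ij ord_max; rewrite !mnmE.
pose q : {mpoly F[2]} := \sum_r c 0 r *: 'X_[mon (enum_val r)].
have qr r : q@_(mon (enum_val r)) = c 0 r.
  rewrite raddf_sum (bigD1 r) //= mcoeffZ mcoeffX eqxx mulr1 big1 ?addr0 // => s sr.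
  rewrite mcoeffZ mcoeffX; case: eqP => [/mon_inj/enum_val_inj sr'|_]; last exact: mulr0.
  by rewrite sr' eqxx in sr.
case/eqP: c0; apply/rowP => r; rewrite mxE -qr (g_ind q) ?mcoeff0 //.
move=> _ [a a0 <-]; apply: (mulIf (expf_neq0 (K * (2 * L)) a0)); rewrite mul0r.
have /(congr1 (fun p : {poly F} => p.[a])) := R0.
rewrite horner0 horner_sum => Ra; rewrite -[RHS]Ra.
rewrite /q raddf_sum mulr_suml /=; apply: eq_bigr => s _.
rewrite mevalZ hornerZ -mulrA; congr (_ * _).
have [i0 j0] : ((enum_val s).1 < L)%N /\ ((enum_val s).2 < L)%N by split; exact: ltn_ord.
rewrite mevalX big_ord_recl big_ord1 !mnmE /= !hornerM !horner_exp hornerX.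
rewrite !PE // !exprMn_comm; try exact: mulrC.
have -> : (K * (2 * L))%N = (K * (enum_val s).1 + K * (enum_val s).2 +
    K * (2 * L - ((enum_val s).1 + (enum_val s).2)))%N.
  by rewrite -!mulnDr subnKC //; lia.
have -> : lift ord0 ord0 = ord_max :> 'I_2 by apply/val_inj.
by rewrite 2!(exprD a) 3!(exprM a) [in RHS]mulrACA -[RHS]mulrA.
Qed.

End DiagonalDimension.

Section DiagonalRotund.
Variable F : numClosedFieldType.
Implicit Types (a : F).

Lemma diag_curve_additively_free : additively_free (@diag_curve F).
Proof.
move=> r c r0 V0; have E a : a != 0 -> a *~ r 0 ord0 = c.
  move=> a0; have := V0 (diag a) (ex_intro2 _ _ a a0 erefl).
  rewrite /leval mevalB mevalC big_ord1 raddfMz => /eqP; rewrite subr_eq0 => /eqP <-.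
  by congr (_ *~ _); rewrite -[RHS]/(leval (LX F ord0) (diag a)) leval_LX mxE.
have := E 1 (oner_neq0 _); rewrite -(E 2) ?pnatr_eq0 //.
rewrite -mulrzl -[2 *~ _]mulrzl => /eqP; rewrite eq_sym -subr_eq0 -mulrBr.
have -> : 2 - 1 = 1 :> F by ring.
rewrite mulr1 intr_eq0 => /eqP r00; case/eqP: r0; apply/rowP => i.
by rewrite mxE (ord1 i).
Qed.

(** Comparing [a] = 1 with [a] = 2 would give 2^r = 1 for a nonzero integer r. *)
Lemma diag_curve_multiplicatively_free : multiplicatively_free (@diag_curve F).
Proof.
move=> r d r0 d0 V0; have E a : a != 0 -> a ^ r 0 ord0 = d.
  move=> a0; have := V0 (diag a) (ex_intro2 _ _ a a0 erefl).
  rewrite /leval mevalB mevalC big_ord1 => /eqP; rewrite subr_eq0 => /eqP <-.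
  rewrite /LYpow; case: (r 0 ord0) => k; rewrite rmorphXn /=.
    by congr (_ ^+ _); rewrite -[RHS]/(leval (LY F ord0) (diag a)) leval_LY mxE.
  rewrite NegzE -exprnN -exprVn; congr (_ ^+ _).
  by rewrite -[RHS]/(leval (LYinv F ord0) (diag a)) leval_LYinv mxE.
have := E 2; rewrite pnatr_eq0 => /(_ isT); rewrite -(E 1 (oner_neq0 _)) exp1rz.
move=> r1.
suff r00 : r 0 ord0 = 0 by case/eqP: r0; apply/rowP => i; rewrite mxE (ord1 i).
have lt k : 1 < 2 ^+ k.+1 :> F by rewrite exprn_egt1 ?ltr1n.
case: (r 0 ord0) r1 => [[|k]|k] //.
  by rewrite -exprnP => r1; have := lt k; rewrite r1 ltxx.
rewrite NegzE -exprnN => /(congr1 GRing.inv); rewrite invrK invr1 => r1.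
by have := lt k; rewrite r1 ltxx.
Qed.

End DiagonalRotund.

Section DiagonalKummer.
Variable F : numClosedFieldType.
Local Notation KR := (kummer_ring F 1).
Local Notation X := (RX F ord0).
Local Notation Y m := (RY F m ord0).
Implicit Types (a : F) (J : set KR) (f g : laurent F 1) (p q : {poly F}).

Lemma RsubstB f g : Rsubst (f - g) = Rsubst f - Rsubst g.
Proof. by rewrite /Rsubst mmapB. Qed.

Lemma RsubstC c : Rsubst (c%:MP : laurent F 1) = RC 1 c.
Proof. exact: mmapC. Qed.

Lemma RsubstX : Rsubst (LX F ord0 : laurent F 1) = X.
Proof.
rewrite /Rsubst mmapX mmap1U (unsplitK (inl (lshift 1 ord0) : 'I_(1 + 1) + 'I_1)).
by rewrite (unsplitK (inl ord0 : 'I_1 + 'I_1)).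
Qed.

Lemma RsubstY : Rsubst (LY F ord0 : laurent F 1) = Y nzint1.
Proof.
rewrite /Rsubst mmapX mmap1U (unsplitK (inl (rshift 1 ord0) : 'I_(1 + 1) + 'I_1)).
by rewrite (unsplitK (inr ord0 : 'I_1 + 'I_1)).
Qed.

Lemma kummer_eval_Rsubst t f : root_system t ->
  kummer_eval (root_point t) (Rsubst f) = leval f (diag (t 1)).
Proof.
move=> rt; have [t0 tD] := rt; have tN : t (-1) = (t 1)^-1.
  have t10 : t 1 != 0 by exact: root_system_neq0.
  by apply: (mulIf t10); rewrite mulVf // -tD addNr t0.
rewrite /Rsubst /mmap /leval mevalE.
rewrite (big_morph _ (kummer_evalD _) (kummer_eval0 _)); apply: eq_bigr => m _.
rewrite kummer_evalM kummer_evalC; congr (_ * _).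
rewrite /mmap1 (big_morph _ (kummer_evalM _) (kummer_eval1 _)); apply: eq_bigr => i _.
rewrite kummer_evalX; congr (_ ^+ _); rewrite mxE; case: splitP => j _; last first.
  rewrite !mxE; apply: etrans (kummer_evalV _ (inr (nzintN1, j))) _.
  by rewrite /= -tN; congr t.
rewrite mxE; case: splitP => l _; rewrite mxE.
  exact: (kummer_evalV _ (inl l)).
apply: etrans (kummer_evalV _ (inr (nzint1, l))) _.
by rewrite /=; congr t.
Qed.

Lemma vanishing_diagP f : vanishing_ideal (@diag_curve F) f <->
  forall a, a != 0 -> leval f (diag a) = 0.
Proof.
split=> [V0 a a0|V0 _ [a a0 <-]]; last exact: V0.
by apply: V0; exists a.
Qed.

Lemma kummer_eval_psubst t p N : root_system t ->
  kummer_eval (root_point t) (psubst p N) = p.[t N.+1%:R^-1].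
Proof.
move=> rt; elim/poly_ind: p => [|p c IH].
  by rewrite psubst0 kummer_eval0 horner0.
rewrite psubstD psubstM psubstC -[psubst 'X N]/(psubst 'X^1 N) psubstXn expr1.
rewrite kummer_evalD kummer_evalM IH hornerMXaddC.
by congr (_ * _ + _); [exact: kummer_evalV|exact: kummer_evalC].
Qed.

Lemma represented_eval t k p N (f : KR) : root_system t ->
    (forall J, coherent_ideal J -> eqmodJ J (f * Y (nzpos N) ^+ k) (psubst p N)) ->
  kummer_eval (root_point t) f * t N.+1%:R^-1 ^+ k = p.[t N.+1%:R^-1].
Proof.
move=> rt /(_ _ (root_system_coherent rt)) /eqP.
rewrite kummer_evalB subr_eq0 kummer_evalM kummer_evalX => /eqP fE.
rewrite -kummer_eval_psubst // -[RHS]fE; congr (_ * _ ^+ _).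
by apply/esym; exact: kummer_evalV.
Qed.

Local Notation I0 := (@pro_cover_ideal F).

Lemma pro_cover_coherent : coherent_ideal I0.
Proof.
split.
- by move=> t rt; exact: coh0 (root_system_coherent rt).
- move=> f g If Ig t rt.
  exact: (@cohD _ _ (root_system_coherent rt) f g (If t rt) (Ig t rt)).
- by move=> f g Ig t rt; exact: (@cohM _ _ (root_system_coherent rt) f g (Ig t rt)).
- by move=> f cf t rt; exact: (@coh_root _ _ (root_system_coherent rt) f cf).
- by move=> f cf t rt; exact: (@coh_inv _ _ (root_system_coherent rt) f cf).
- by move=> t rt; exact: cohXY (root_system_coherent rt).
Qed.

Lemma trivial_system : root_system (fun=> 1 : F).
Proof. by split=> // x y; rewrite mulr1. Qed.

(** Up to powers of a unit, two elements are polynomials in a common Y_N, which takes every nonzero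
    value on root systems. If the product of the elements is in the ideal, the product of the
    polynomials is 0, hence one of them is. *)
Lemma pro_cover_prime : prime_ideal I0.
Proof.
split; first split.
- exact/mem_set/(coh0 pro_cover_coherent).
- apply/negP => /set_mem /(_ _ trivial_system) /eqP.
  by rewrite kummer_eval1 oner_eq0.
- move=> h f g /set_mem If /set_mem Ig; apply/mem_set.
  exact: (cohD pro_cover_coherent) (cohM pro_cover_coherent h If) Ig.
move=> f g /set_mem fg; apply: contraT; rewrite negb_or => /andP[nf ng].
have [N1 H1] := represented_multiple f; have [N2 H2] := represented_multiple g.
pose N := (N1.+1 * N2.+1).-1.
have [k [p pE]] := H1 N2; have [l [q]] := H2 N1; rewrite mulnC => qE.
rewrite -/N in pE qE.
have p0 : p != 0.
  apply: contraNneq nf => p0; apply/mem_set => t rt.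
  have := represented_eval rt pE; rewrite p0 horner0 => /eqP.
  by rewrite mulf_eq0 expf_eq0 (negbTE (root_system_neq0 _ rt)) andbF orbF => /eqP.
have q0 : q != 0.
  apply: contraNneq ng => q0; apply/mem_set => t rt.
  have := represented_eval rt qE; rewrite q0 horner0 => /eqP.
  by rewrite mulf_eq0 expf_eq0 (negbTE (root_system_neq0 _ rt)) andbF orbF => /eqP.
have /eqP : p * q = 0.
  apply: poly_eq0_nonzero => s s0; have [t rt ts] := root_system_exists N s0.
  rewrite hornerM -ts -(represented_eval rt pE) -(represented_eval rt qE).
  by rewrite mulrACA -kummer_evalM (fg t rt) mul0r.
by rewrite mulf_eq0 (negbTE p0) (negbTE q0).
Qed.

Lemma pro_cover_level1 : level1 I0 = vanishing_ideal (@diag_curve F).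
Proof.
rewrite predeqE => f; rewrite vanishing_diagP; split=> [If a a0|V0 t rt].
  have [t rt t1] := root_system_exists 0 a0; rewrite invr1 in t1.
  by rewrite -t1 -kummer_eval_Rsubst //; exact: If.
by rewrite kummer_eval_Rsubst //; apply: V0; exact: root_system_neq0.
Qed.

Lemma Rsubst_linear (r : 'rV[int]_1) c :
  Rsubst (\sum_i LX F i *~ r 0 i - c%:MP) = \sum_i RX F i *~ r 0 i - RC 1 c.
Proof.
rewrite RsubstB RsubstC !big_ord1; congr (_ - _).
by rewrite /Rsubst raddfMz /= -RsubstX.
Qed.

(** Split [p] into linear factors: the leading coefficient is a unit, so primality puts one of the
    factors in [J]. *)
Lemma prime_poly_root J p N : prime_ideal J -> coherent_ideal J -> p != 0 ->
  J (psubst p N) -> exists a, J (Y (nzpos N) - RC 1 a).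
Proof.
move=> [[_ J1 _] Jp] cJ p0; have [r pE] := closed_field_poly_normal p.
rewrite {}pE -mul_polyC psubstM psubstC => /mem_set /Jp /orP[/set_mem Jc|/set_mem].
  have lE : RC 1 (lead_coef p)^-1 * RC 1 (lead_coef p) = 1.
    by rewrite -(rmorphM (RC 1)) mulVf ?lead_coef_eq0 // (rmorph1 (RC 1)).
  by case/negP: J1; apply/mem_set; have := cohM cJ (RC 1 (lead_coef p)^-1) Jc; rewrite lE.
elim: r => [|z r IH].
  by rewrite big_nil -polyC1 psubstC rmorph1 => J1'; case/negP: J1; apply/mem_set.
rewrite big_cons psubstM => /mem_set /Jp /orP[/set_mem Jz|/set_mem]; last exact: IH.
exists z; move: Jz; rewrite psubstD -polyCN psubstC rmorphN.
by rewrite -[psubst 'X N]/(psubst 'X^1 N) psubstXn expr1.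
Qed.

(* Modulo any admissible ideal J, an element is p(Y_N) up to a power of the unit
   Y_N, and p(Y_N) lies in J only if p = 0: otherwise, J being prime and F
   algebraically closed, Y_N, hence Y_1, would be constant modulo J. *)
Lemma Kummer_generic_diag_curve : Kummer_generic (@diag_curve F).
Proof.
split; first exact: diag_curve_additively_free.
exists I0; split.
  have cI := pro_cover_coherent.
  split; [exact: pro_cover_prime| |exact: coh_root|exact: coh_inv|];
    last exact: pro_cover_level1.
  move=> r c r0 Ic; apply: (@diag_curve_additively_free F r c r0).
  by rewrite -pro_cover_level1 /level1 /mkset Rsubst_linear.
move=> J [pJ _ Jr Ji J1].
have cJ : coherent_ideal J.
  have [[J0 _ JD] _] := pJ; have {}J0 : J 0 by exact: set_mem J0.
  split=> // [f g Jf Jg|f g Jg|].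
  - by rewrite -[f]mul1r; apply/set_mem/JD; exact: mem_set.
  - by rewrite -[_ * _]addr0; apply/set_mem/JD; exact: mem_set.
  - rewrite -RsubstX -RsubstY -RsubstB -[J _]/(level1 J _) J1 vanishing_diagP => a a0.
    by rewrite /leval mevalB -!/(leval _ _) leval_LX leval_LY !mxE subrr.
have notJ p N : p != 0 -> ~ J (psubst p N).
  move=> p0 Jpp; have [a Ja] := prime_poly_root pJ cJ p0 Jpp.
  have : J (Y nzint1 - RC 1 (a ^+ N.+1)).
    have : eqmodJ J (Y nzint1) (RC 1 a ^+ N.+1).
      apply: (eqmodJ_trans cJ) (eqmodJ_exp cJ N.+1 Ja).
      by apply: (eqmodJ_root cJ) => //=; rewrite mul1r.
    by rewrite -rmorphXn.
  rewrite -RsubstY -RsubstC -RsubstB -[J _]/(level1 J _) J1 vanishing_diagP => V0.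
  have E b : b != 0 -> b = a ^+ N.+1.
    move=> /V0; rewrite /leval mevalB mevalC -!/(leval _ _) leval_LY mxE => /eqP.
    by rewrite subr_eq0 => /eqP.
  have /eqP := E 1 (oner_neq0 _); rewrite -(E 2) ?pnatr_eq0 //.
  by rewrite -[1]/(1%:R) eqr_nat.
rewrite predeqE => f; have [N /(_ 0%N) [k [p pE]]] := represented_multiple f.
rewrite muln1 /= in pE.
split=> [If|Jf].
  have p0 : p = 0.
    apply: poly_eq0_nonzero => s s0; have [t rt ts] := root_system_exists N s0.
    by rewrite -ts -(represented_eval rt pE) (If t rt) mul0r.
  have := pE J cJ; rewrite p0 psubst0 => fJ.
  have Jfk : J (f * Y (nzpos N) ^+ k) by move: fJ; rewrite /eqmodJ subr0.
  (* Modulo [J], this factor is the inverse of the power of Y_N. *)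
  have := cohM cJ (Y (nzneg N) ^+ k) Jfk; rewrite mulrCA -exprMn_comm; last exact: mulrC.
  move=> Jk; apply: (eqmodJ_mem cJ) Jk; rewrite -[X in eqmodJ _ X]mulr1.
  apply: (eqmodJ_mul cJ (eqmodJ_refl cJ f)); apply: (eqmodJ_sym cJ).
  rewrite -[X in eqmodJ _ _ X](expr1n _ k); apply: (eqmodJ_exp cJ).
  by rewrite mulrC; exact: eqmodJ_inv.
have p0 : p = 0.
  apply/eqP; apply: contrapT => /negP p0; apply: (notJ p N p0).
  apply: (eqmodJ_mem cJ) (cohM cJ (Y (nzpos N) ^+ k) Jf).
  by rewrite mulrC; apply: (eqmodJ_sym cJ); exact: pE.
move=> t rt; have := represented_eval rt pE; rewrite p0 horner0 => /eqP.
by rewrite mulf_eq0 expf_eq0 (negbTE (root_system_neq0 _ rt)) andbF orbF => /eqP.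
Qed.

End DiagonalKummer.

Lemma diag_curve_perfectly_rotund (F : numClosedFieldType) :
  perfectly_rotund (@diag_curve F).
Proof.
split.
- exact: diag_curve_irreducible.
- split; [exact: diag_curve_dim_ge1|exact: diag_curve_dim_lt2].
- by move=> M; case: (mx_rank M).
- split; [exact: diag_curve_additively_free|exact: diag_curve_multiplicatively_free|].
  exact: Kummer_generic_diag_curve.
Qed.

(** * Absence of generic points over the algebraic numbers *)

Lemma divring_closed_rat (F : numFieldType) (B : set F) (q : rat) :
  divring_closed (mem B) -> B (ratr q).
Proof.
move=> [B1 BB BV]; have B0 : 0 \in mem B by rewrite -(subrr 1) BB.
have BD x y : x \in mem B -> y \in mem B -> x + y \in mem B.
  by move=> Bx By; rewrite -[y]opprK BB // -sub0r BB.
have Bn n : n%:R \in mem B.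
  by elim: n => [|n IH]; rewrite ?mulr0n // -natr1 BD.
have Bz (z : int) : z%:~R \in mem B.
  by case: z => n; rewrite ?NegzE ?mulrNz -pmulrn ?Bn // -sub0r BB.
by apply/set_mem; rewrite /ratr BV.
Qed.

Lemma mpolyOver_coef (R : nzRingType) n (A : set R) (p : {mpoly R[n]}) :
  (forall m, A p@_m) -> p \is a mpolyOver n (mem A).
Proof. by move=> Ap; rewrite qualifE; apply/allP => _ /mapP[m _ ->]; exact/mem_set. Qed.

(** Let [A] be the subfield generated by the empty list. The minimal polynomial over Q of the
    coordinate [b] defines a closed set over [A] containing the point, so genericity would make it
    vanish at every nonzero [a]. *)
Lemma not_strongly_exp_alg_closed_algC (e : algC -> algC) :
  ~ strongly_exp_alg_closed e.
Proof.
move=> [_ /(_ 1%N (@diag_curve algC))].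
pose A := smallest [set B : set algC | divring_closed (mem B)] [set` [::]].
have Aq q : A (ratr q) by move=> B [/= cB _]; exact: divring_closed_rat.
have finA : fin_gen_subfield A by exists [::].
have defA : defined_over A (@diag_curve algC).
  exists [set LX algC ord0 - LY algC ord0]; last exact: diag_curveE.
  move=> _ ->; apply: mpolyOver_coef => m; rewrite mcoeffB !mcoeffX.
  have := Aq ((U_(lshift 1 (lshift 1 ord0)) == m)%MM%:R -
              (U_(lshift 1 (rshift 1 ord0)) == m)%MM%:R).
  by rewrite rmorphB /= !ratr_nat.
move=> /(_ A (@diag_curve_perfectly_rotund _) finA defA) [b [Vb bgen]].
have [q [qE qmon] _] := minCpolyP (b ord0 0).
pose P : {mpoly algC[1 + 1 + 1]} := \sum_(i < size q) ratr q`_i *: LX algC ord0 ^+ i.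
have PE p : leval P p = (map_poly ratr q).[p.1 ord0 0].
  rewrite /leval /P raddf_sum horner_coef size_map_poly /=; apply: eq_bigr => i _.
  rewrite mevalZ coef_map rmorphXn; congr (_ * _ ^+ _).
  exact: leval_LX.
have defP : defined_over A (zero_locus [set P]).
  exists [set P] => // _ ->; apply: mpolyOver_coef => m.
  have := Aq (\sum_(i < size q) q`_i * ((U_(lshift 1 (lshift 1 ord0)) *+ i)%MM == m)%:R).
  congr A; rewrite rmorph_sum raddf_sum; apply: eq_bigr => i _.
  by rewrite rmorphM /= ratr_nat mcoeffZ mpolyXn mcoeffX.
have /poly_eq0_nonzero q0 a : a != 0 -> (map_poly ratr q).[a] = 0 :> algC.
  move=> a0; have [|_ /(_ P erefl)] := bgen _ defP _ (diag a) (ex_intro2 _ _ a a0 erefl).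
    split=> [|_ ->]; last by rewrite PE -qE; exact/rootP/root_minCpoly.
    by case: Vb => c c0 <- i; rewrite mxE.
  by rewrite PE mxE.
have /eqP := monic_neq0 qmon; apply; apply/eqP.
by rewrite -(map_poly_eq0 (@ratr algC)) q0.
Qed.

Theorem theorem8p2 :
  exists (F : fieldType) (e : F -> F),
    [/\ ELA_field e, schanuel_nullstellensatz e & ~ strongly_exp_alg_closed e].
Proof.
have [e [ELA sn]] := limit_exponential.
by exists algC, e; split=> //; exact: not_strongly_exp_alg_closed_algC.
Qed.
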